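(* Let $d\ge1$ be an integer, $h\in(0,1]$, $C>0$, $M>0$. Assume $P\in\mathcal{D}^{(h,C,M)}$, let $n\ge1$ and $1\le k_n\le n$ be integers, and let $\hat F_n$ be the $k$-nearest neighbor model $$\hat F_{n,x}(z)=\frac{1}{k_n}\sum_{i=1}^{k_n}\mathbf{1}_{Y_{i:n}(x)\le z}.$$ Then $$\mathbb{E}_{D_n\sim P^n}[R_P(\hat F_n)]-R_P(F^\ast)\le\begin{cases}8^hC^2\left(\dfrac{k_n}{n}\right)^h+\dfrac{M}{k_n}&\text{if }d=1,\\[2mm] c_d^{\,h}C^2\left(\dfrac{k_n}{n}\right)^{2h/d}+\dfrac{M}{k_n}&\text{if }d\ge2,\end{cases}$$ where $c_d=\dfrac{2^{3+\frac2d}(1+\sqrt d)^2}{V_d^{2/d}}$ and $V_d$ is the volume of the unit ball in $\mathbb{R}^d$.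
   Context: Setting: $(X,Y)\in\mathbb{R}^d\times\mathbb{R}$ is a random pair with distribution $P$, $P_X$ is the marginal law of $X$, and $F^\ast_x(y)=P(Y\le y\mid X=x)$ is the conditional distribution function of $Y$ given $X=x$ (a version of it). The training sample is $D_n=\{(X_i,Y_i),1\le i\le n\}\sim P^n$ (i.i.d. with law $P$), independent of the test pair $(X,Y)\sim P$. For a distribution function $F$ and $y\in\mathbb{R}$, $\mathrm{CRPS}(F,y)=\int_{\mathbb{R}}(F(z)-\mathbf{1}_{y\le z})^2\,dz$. The risk of a predictor $\hat F:x\mapsto\hat F_x$ is $R_P(\hat F)=\mathbb{E}_{(X,Y)\sim P}[\mathrm{CRPS}(\hat F_X,Y)]$. When $Y$ is integrable, the excess risk satisfies $\mathbb{E}_{D_n\sim P^n}[R_P(\hat F_n)]-R_P(F^\ast)=\mathbb{E}_{D_n\sim P^n,X\sim P_X}\left[\int_{\mathbb{R}}|\hat F_{n,X}(z)-F^\ast_X(z)|^2\,dz\right]$. $Y_{i:n}(x)$ denotes the response associated with the $i$-th nearest neighbor of $x$ among $X_1,\dots,X_n$ (Euclidean distance, ties broken at random). For $h\in(0,1]$, $C>0$, $M>0$, $\mathcal{D}^{(h,C,M)}$ is the class of distributions $P$ of $(X,Y)$ such that: i) $X\in[0,1]^d$ $P_X$-a.s.; ii) for all $x\in[0,1]^d$, $\int_{\mathbb{R}}F^\ast_x(z)(1-F^\ast_x(z))\,dz\le M$; iii) $\|F^\ast_{x'}-F^\ast_x\|_{L^2}\le C\|x'-x\|^h$ for all $x,x'\in[0,1]^d$,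 where $\|\cdot\|_{L^2}$ is the norm of $L^2(\mathbb{R})$ (Lebesgue measure) and $\|\cdot\|$ is the Euclidean norm. *)

(* Defs.v *)
From HB Require Import structures.
From mathcomp Require Import all_boot all_order all_algebra.
From mathcomp Require Import fingroup perm.
From mathcomp Require Import all_classical all_reals all_analysis.

Set Implicit Arguments.
Unset Strict Implicit.
Unset Printing Implicit Defensive.

Import Order.TTheory GRing.Theory Num.Theory.
Import numFieldNormedType.Exports.

Local Open Scope classical_set_scope.
Local Open Scope ring_scope.

(* The n-fold product of a sigma-finite measure, on n.-tuple T equipped with
   the product sigma-algebra: the image under (x, t) |-> x :: t of the product
   of mu with the n-fold product (see mpow_box). *)
Section mpow.
Context d (T : measurableType d) (R : realType).

Definition tcons n (p : T * n.-tuple T) : n.+1.-tuple T :=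
  [tuple of p.1 :: p.2].

Lemma measurable_tcons n : measurable_fun setT (@tcons n).
Proof. exact: measurable_cons. Qed.

Section mcons.
Variables (mu : {sigma_finite_measure set T -> \bar R}) (n : nat).
Variable nu : {sigma_finite_measure set (n.-tuple T) -> \bar R}.

Definition mcons : set (n.+1.-tuple T) -> \bar R :=
  pushforward (mu \x nu)%E (@tcons n).

Let mtcons A : measurable A -> measurable (@tcons n @^-1` A).
Proof. by rewrite -[X in _ -> measurable X]setTI; exact: measurable_tcons. Qed.

Let mcons0 : mcons set0 = 0%E.
Proof. by rewrite /mcons /pushforward preimage_set0 measure0. Qed.

Let mcons_ge0 A : (0 <= mcons A)%E.
Proof. by rewrite /mcons /pushforward; exact: measure_ge0. Qed.

Let mcons_sigma_additive : semi_sigma_additive mcons.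
Proof.
move=> F mF tF mUF; rewrite /mcons /pushforward preimage_bigcup.
apply: measure_semi_sigma_additive.
- by move=> i; exact: mtcons.
- apply/trivIsetP => /= i j _ _ ij; rewrite -preimage_setI.
  by move/trivIsetP : tF => /(_ _ _ _ _ ij) ->//; rewrite preimage_set0.
- by rewrite -preimage_bigcup; exact: mtcons.
Qed.

HB.instance Definition _ := isMeasure.Build _ _ _ mcons
  mcons0 mcons_ge0 mcons_sigma_additive.

Let mcons_sigma_finite : sigma_finite setT mcons.
Proof.
have /sigma_finiteP[F [TF ndF Foo]] := sigma_finiteT mu.
have /sigma_finiteP[G [TG ndG Goo]] := sigma_finiteT nu.
pose g (t : n.+1.-tuple T) := (thead t, [tuple of behead t]).
have gK : cancel (@tcons n) g.
  by move=> [x t]; rewrite /g /tcons theadE/=; congr pair; apply/val_inj.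
have mg : measurable_fun setT g.
  apply/measurable_fun_pairP; split; first exact: measurable_tnth.
  exact: measurable_behead.
exists (fun i => g @^-1` (F i `*` G i)).
  apply/seteqP; split => // t _.
  have [i _ Fi] : (\bigcup_i F i) (g t).1 by rewrite -TF.
  have [j _ Gj] : (\bigcup_i G i) (g t).2 by rewrite -TG.
  exists (maxn i j) => //; split.
    by move: Fi; exact/subsetPset/ndF/leq_maxl.
  by move: Gj; exact/subsetPset/ndG/leq_maxr.
move=> i; have [mF Fi] := Foo i; have [mG Gi] := Goo i; split.
  by rewrite -[X in measurable X]setTI; apply: mg => //; exact: measurableX.
rewrite /mcons /pushforward -comp_preimage (_ : g \o @tcons n = id).
  by rewrite preimage_id product_measure1E// lte_mul_pinfty// ge0_fin_numE.
by apply/funext => p; exact: gK.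
Qed.

HB.instance Definition _ := Measure_isSigmaFinite.Build _ _ _ mcons
  mcons_sigma_finite.

End mcons.

Fixpoint mpow (mu : {sigma_finite_measure set T -> \bar R}) n :
    {sigma_finite_measure set (n.-tuple T) -> \bar R} :=
  if n is m.+1 then mcons mu (mpow mu m) else \d_([tuple] : 0.-tuple T).

Lemma mpow_box (mu : {sigma_finite_measure set T -> \bar R}) n
    (A : 'I_n -> set T) : (forall i, measurable (A i)) ->
  mpow mu n [set t | forall i, A i (tnth t i)] = (\prod_(i < n) mu (A i))%E.
Proof.
elim: n A => [|n IH] A mA.
  by rewrite big_ord0 /= diracE mem_set//= => -[].
pose B : set (n.-tuple T) := [set t | forall i, A (lift ord0 i) (tnth t i)].
have mB : measurable B.
  rewrite (_ : B = \bigcap_(i in [set: 'I_n])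
                     ((fun t : n.-tuple T => tnth t i) @^-1` A (lift ord0 i))).
    apply: fin_bigcap_measurable => // i _.
    by rewrite -[X in measurable X]setTI; exact: measurable_tnth.
  by apply/seteqP; split => [t Bt i _|t Bt i]; [exact: Bt|exact: (Bt i I)].
rewrite big_ord_recl -(IH (fun i => A (lift ord0 i)))// -product_measure1E//=.
rewrite /mcons /pushforward; congr (_ _); apply/seteqP; split => -[x t] /=.
  move=> H; split; first exact: (H ord0).
  by move=> i; have := H (lift ord0 i); rewrite tnthS.
case=> Ax Bt i; have [j ->|->//] := unliftP ord0 i.
by rewrite tnthS; exact: Bt.
Qed.

End mpow.

(* R^d is d.-tuple R, which the library equips with the product (i.e. Borel)
   sigma-algebra, but not with a norm. *)
Section euclidean.
Context {R : realType} (d : nat).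
Implicit Types x y : d.-tuple R.

Definition eucl_norm x : R := Num.sqrt (\sum_(i < d) tnth x i ^+ 2).

Definition eucl_dist x y : R := eucl_norm [tuple tnth x i - tnth y i | i < d].

Definition unit_cube : set (d.-tuple R) :=
  [set x | forall i, 0 <= tnth x i <= 1].

Definition unit_ball_volume : R :=
  fine (mpow (@lebesgue_measure R) d [set x | eucl_norm x <= 1]).

End euclidean.
Arguments unit_cube {R} d.
Arguments unit_ball_volume R d : clear implicits.

HB.instance Definition _ d1 d2 (T1 : measurableType d1)
    (T2 : measurableType d2) :=
  isMeasurableFun.Build _ _ (T1 * T2)%type T1 fst measurable_fst.

Section risk.
Context {R : realType} (d : nat).
Local Notation mu := (@lebesgue_measure R).
Implicit Type P : probability (d.-tuple R * R)%type R.

Definition CRPS (F : R -> R) (y : R) : \bar R :=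
  (\int[mu]_z ((F z - (y <= z)%R%:R) ^+ 2)%:E)%E.

Definition risk P (F : d.-tuple R -> R -> R) : \bar R :=
  (\int[P]_p CRPS (F p.1) p.2)%E.

(* F is a version of the conditional distribution function of Y given X,
   where (X, Y) has law P; cumulativeBounded 0 1 is the type of distribution
   functions of probability measures on R. *)
Definition is_cond_cdf P (F : d.-tuple R -> cumulativeBounded (0 : R) (1 : R)) :=
  (forall y, measurable_fun setT (fun x => F x y)) /\
  forall (A : set (d.-tuple R)) (y : R), measurable A ->
    P (A `*` `]-oo, y]) = (\int[distribution P fst]_(x in A) (F x y)%:E)%E.

(* The conditions are imposed on some version F of the conditional
   distribution function. *)
Definition class_D (h C M : R) P :=
  exists F : d.-tuple R -> cumulativeBounded (0 : R) (1 : R),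
  [/\ is_cond_cdf P F,
      {ae distribution P fst, forall x, unit_cube d x},
      forall x, unit_cube d x ->
        (\int[mu]_z (F x z * (1 - F x z))%:E <= M%:E)%E
    & forall x x', unit_cube d x -> unit_cube d x' ->
        ('N[mu]_2%:E [EFin \o (F x' \- F x)%R]
           <= (C * eucl_dist x' x `^ h)%:E)%E].

End risk.

Section knn.
Context {R : realType} (d n : nat).
Variables (D : n.-tuple (d.-tuple R * R)) (s : 'S_n).

(* i comes before j in the ordering by distance to x; the permutation s,
   drawn uniformly at random, gives the priorities used to break ties. *)
Definition nn_le (x : d.-tuple R) : rel 'I_n := fun i j =>
  let r i := eucl_dist (tnth D i).1 x in
  (r i < r j) || ((r i == r j) && (s i <= s j)%N).

(* nn_response x i is Y_{i+1:n}(x). *)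
Definition nn_response (x : d.-tuple R) (i : nat) : R :=
  nth 0 [seq (tnth D j).2 | j <- sort (nn_le x) (enum 'I_n)] i.

Definition knn (k : nat) (x : d.-tuple R) (z : R) : R :=
  k%:R^-1 * \sum_(i < k) (nn_response x i <= z)%R%:R.

End knn.

(* Expectation over the sample D ~ P^n and over the independent uniform
   tie-breaking permutation. *)
Definition expected_risk_knn {R : realType} (d : nat)
    (P : probability (d.-tuple R * R)%type R) (n k : nat) : \bar R :=
  (\int[mpow P n]_D
     ((n`!%:R^-1)%:E * \sum_(s : 'S_n) risk P (knn D s k)))%E.

Definition nn_constant (R : realType) (d : nat) : R :=
  2 `^ (3 + 2 / d%:R) * (1 + Num.sqrt d%:R) ^+ 2
    / unit_ball_volume R d `^ (2 / d%:R).

(* Main.v *)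
Require Import Defs.
From mathcomp Require Import all_boot all_order all_algebra.
From mathcomp Require Import fingroup perm.
From mathcomp Require Import all_classical all_reals all_analysis.
From mathcomp Require Import measurable_realfun.
From mathcomp Require Import ring lra zify.

(* Condition on the covariates: given X_1, ..., X_n and X, the responses are
   independent with distribution functions F_{X_i}, so for fixed z the expected
   squared error splits into a squared bias, the irreducible variance
   F_X(z) (1 - F_X(z)) and a term at most M / k after integration in z. The
   test point enters as one more sample point whose response has weight -1. By
   convexity and the Hoelder condition the bias is at most C^2 times the mean
   of |X_(i) - X|^(2h) over the k nearest neighbours X_(i). Splitting the
   sample into k blocks of size m = floor(n / k), the k nearest neighbours are
   at least as close as the k nearest neighbours within the blocks, so it
   suffices to bound E|X_(1) - X|^(2h) for m points. By exchangeability, this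
   is the mean over m + 1 sample points of the power 2h of the distance R_j to
   the nearest other point; the balls B(X_j, R_j / 2) being disjoint, the sum
   of the R_j^d is bounded, and the mean of the powers is bounded by concavity.
   For a version Fstar other than the one satisfying the Hoelder condition,
   only the inequality irreducible risk <= risk of Fstar is needed. *)

Set Implicit Arguments.
Unset Strict Implicit.
Unset Printing Implicit Defensive.

Import Order.TTheory GRing.Theory Num.Theory.
Import numFieldNormedType.Exports.

Local Open Scope classical_set_scope.
Local Open Scope ring_scope.

(** * Elementary inequalities *)

Section power_mean.
Context {R : realType}.

(** Concavity of the power: its graph lies below the tangent at [1]. This is Young's inequality for
    the product of [u ^ a] and [1], with conjugate exponents [1 / a] and [1 / (1 - a)]; [a = 1] is
    an equality. *)
Lemma powR_le_tangent (u a : R) : 0 <= u -> 0 < a -> a <= 1 ->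
  u `^ a <= 1 + a * (u - 1).
Proof.
move=> u0 a0; rewrite le_eqVlt => /predU1P[->|a1].
  by rewrite powRr1// mul1r addrC subrK.
have q0 : 0 < 1 - a by rewrite subr_gt0.
have := @conjugate_powR R (u `^ a) 1 a^-1 (1 - a)^-1 (powR_ge0 _ _) ler01.
rewrite !invr_gt0 a0 q0 !invrK => /(_ isT isT).
rewrite addrC subrK => /(_ erefl).
rewrite mulr1 -powRrM mulfV ?gt_eqF// powRr1// powR1 mul1r => /le_trans; apply.
lra.
Qed.

(** Jensen's inequality for a concave power. Each term is bounded by the tangent at [c], obtained
    from the one at [1] by scaling; its slope is nonnegative, so an upper bound [c] on the mean is
    enough. *)
Lemma sum_powR_le (I : finType) (s : I -> R) (a c : R) :
  (forall i, 0 <= s i) -> 0 < a -> a <= 1 -> 0 < c ->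
  \sum_i s i <= #|I|%:R * c -> \sum_i s i `^ a <= #|I|%:R * c `^ a.
Proof.
move=> s0 a0 a1 c0 sc.
have term i : s i `^ a <= c `^ a * (1 - a) + c `^ a * a / c * s i.
  have -> : s i = c * (s i / c) by rewrite mulrC divfK ?gt_eqF.
  rewrite powRM ?divr_ge0 ?(ltW c0)//.
  have := powR_le_tangent (divr_ge0 (s0 i) (ltW c0)) a0 a1.
  move=> tan; apply: le_trans (ler_wpM2l (powR_ge0 c a) tan) _.
  rewrite le_eqVlt; apply/orP; left; apply/eqP; field.
  by rewrite gt_eqF.
apply: (@le_trans _ _ (\sum_i (c `^ a * (1 - a) + c `^ a * a / c * s i))).
  exact: ler_sum.
rewrite big_split/= sumr_const -mulr_sumr -[X in X + _]mulr_natl.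
have k0 : 0 <= c `^ a * a / c.
  by rewrite divr_ge0 ?mulr_ge0 ?powR_ge0// ltW.
apply: le_trans (lerD (lexx _) (ler_wpM2l k0 sc)) _.
rewrite le_eqVlt; apply/orP; left; apply/eqP; field.
by rewrite gt_eqF.
Qed.

End power_mean.

(** * Euclidean distance *)

Section eucl_dist_theory.
Context {R : realType} (d : nat).
Implicit Types x y z : d.-tuple R.

Lemma eucl_distE x y :
  eucl_dist x y = Num.sqrt (\sum_(i < d) (tnth x i - tnth y i) ^+ 2).
Proof.
by rewrite /eucl_dist /eucl_norm; under eq_bigr do rewrite tnth_mktuple.
Qed.

Lemma eucl_dist_ge0 x y : 0 <= eucl_dist x y.
Proof. exact: sqrtr_ge0. Qed.

Lemma eucl_distC x y : eucl_dist x y = eucl_dist y x.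
Proof.
rewrite !eucl_distE; congr Num.sqrt; apply: eq_bigr => i _.
by rewrite -sqrrN opprB.
Qed.

Lemma eucl_dist_lt x y (r : R) : 0 < r ->
  (eucl_dist x y < r) = (\sum_(i < d) (tnth x i - tnth y i) ^+ 2 < r ^+ 2).
Proof.
move=> r0; rewrite eucl_distE -{1}(@ger0_norm _ r) ?(ltW r0)// -sqrtr_sqr.
by rewrite ltr_sqrt// exprn_gt0.
Qed.

(* Minkowski: [(a + b)^2 <= (r + s) (a^2 / r + b^2 / s)] *)
Lemma eucl_dist_triangle_lt x y z (r s : R) :
  eucl_dist x y < r -> eucl_dist y z < s -> eucl_dist x z < r + s.
Proof.
move=> xy yz; have r0 := le_lt_trans (eucl_dist_ge0 _ _) xy.
have s0 := le_lt_trans (eucl_dist_ge0 _ _) yz.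
rewrite eucl_dist_lt ?addr_gt0//.
move: xy yz; rewrite !eucl_dist_lt//.
set A := \sum_(i < d) _; set B := \sum_(i < d) _ => Ar Bs.
have sq_le (a b : R) : (a + b) ^+ 2 <= (r + s) * (a ^+ 2 / r + b ^+ 2 / s).
  rewrite -subr_ge0.
  have -> : (r + s) * (a ^+ 2 / r + b ^+ 2 / s) - (a + b) ^+ 2
            = (a * s - b * r) ^+ 2 / (r * s).
    by field; rewrite !gt_eqF.
  by rewrite divr_ge0 ?sqr_ge0 ?mulr_ge0 ?ltW.
apply: (@le_lt_trans _ _ ((r + s) * (A / r + B / s))).
  rewrite /A /B !mulr_suml -big_split mulr_sumr/=; apply: ler_sum => i _.
  by rewrite (le_trans _ (sq_le _ _))// subrKA.
have ->: (r + s) ^+ 2 = (r + s) * (r ^+ 2 / r + s ^+ 2 / s).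
  by field; rewrite !gt_eqF.
by rewrite ltr_pM2l ?addr_gt0// ltrD// ltr_pM2r ?invr_gt0.
Qed.

Lemma unit_cube_eucl_dist_le x y : unit_cube d x -> unit_cube d y ->
  eucl_dist x y <= Num.sqrt d%:R.
Proof.
move=> cx cy; rewrite eucl_distE ler_sqrt ?ler0n//.
have -> : d%:R = \sum_(i < d) (1 : R) by rewrite sumr_const card_ord.
by apply: ler_sum => i _; have := cx i; have := cy i; nra.
Qed.

End eucl_dist_theory.

(** * Nearest-neighbor order and weights *)

Section nearest_neighbors.
Context {R : realType} (d n : nat).
Variables (D : n.-tuple (d.-tuple R * R)) (s : 'S_n).
Implicit Types x : d.-tuple R.

Definition nn_order x : seq 'I_n := sort (nn_le D s x) (enum 'I_n).

Definition nn_weight (k : nat) x (j : 'I_n) : R :=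
  k%:R^-1 * (j \in take k (nn_order x))%:R.

Lemma nn_le_total x : total (nn_le D s x).
Proof.
move=> i j; rewrite /nn_le; case: ltgtP => //= _.
by rewrite leq_total.
Qed.

Lemma nn_le_trans x : transitive (nn_le D s x).
Proof.
move=> j i l; rewrite /nn_le.
move=> /orP[ij|/andP[/eqP-> ij]] /orP[jl|/andP[/eqP<- jl]].
- by rewrite (lt_trans ij jl).
- by rewrite ij.
- by rewrite jl.
- by rewrite eqxx (leq_trans ij jl) orbT.
Qed.

Lemma uniq_nn_order x : uniq (nn_order x).
Proof. by rewrite sort_uniq enum_uniq. Qed.

Lemma size_nn_order x : size (nn_order x) = n.
Proof. by rewrite size_sort size_enum_ord. Qed.

Lemma mem_nn_order x j : j \in nn_order x.
Proof. by rewrite mem_sort mem_enum. Qed.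

Lemma card_take_nn_order k x : (k <= n)%N -> #|take k (nn_order x)| = k.
Proof.
move=> kn; rewrite (card_uniqP _) ?take_uniq ?uniq_nn_order//.
by rewrite size_takel// size_nn_order.
Qed.

(** Since [nn_le] is total and transitive, sorting makes the list pairwise ordered; [j] lies in the
    dropped part, hence after [i]. *)
Lemma take_nn_order_le k x i j :
  i \in take k (nn_order x) -> j \notin take k (nn_order x) ->
  eucl_dist (tnth D i).1 x <= eucl_dist (tnth D j).1 x.
Proof.
move=> ik jk; have jd : j \in drop k (nn_order x).
  have := mem_nn_order x j.
  by rewrite -{1}(cat_take_drop k (nn_order x)) mem_cat (negbTE jk).
have := sort_sorted (nn_le_total x) (enum 'I_n).
rewrite -/(nn_order x) (sorted_pairwise (@nn_le_trans x)).
rewrite -{1}(cat_take_drop k (nn_order x)) pairwise_cat.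
move=> /andP[/allrelP/(_ _ _ ik jd)].
by rewrite /nn_le => /orP[/ltW//|/andP[/eqP->]].
Qed.

(** Reindexing ranks by sample points turns the estimator into a weighted sum of the indicators
    whose weights depend on the covariates alone; conditioning on the covariates then leaves the
    weights fixed. *)
Lemma knnE k x z : (k <= n)%N ->
  knn D s k x z = \sum_(j < n) nn_weight k x j * ((tnth D j).2 <= z)%R%:R.
Proof.
move=> kn; rewrite /knn /nn_weight -/(nn_order x).
under [RHS]eq_bigr do rewrite -mulrA; rewrite -mulr_sumr; congr (_ * _).
transitivity (\sum_(j in take k (nn_order x)) ((tnth D j).2 <= z)%R%:R : R);
    last first.
  rewrite big_mkcond/=; apply: eq_bigr => j _.
  by case: ifP => _; rewrite ?mul1r ?mul0r.
rewrite -big_uniq ?take_uniq ?uniq_nn_order//=.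
(* The case [k = 0] is separate because [nth] on a list of indices needs a default in ['I_n], which
   exists once [0 < k <= n]. *)
case: (posnP k) kn => [-> _|k0 kn]; first by rewrite big_ord0 take0 big_nil.
pose i0 : 'I_n := Ordinal (leq_trans k0 kn).
have sk : size (take k (nn_order x)) = k by rewrite size_takel// size_nn_order.
rewrite (big_nth i0) sk big_mkord; apply: eq_bigr => i _.
rewrite nth_take// /nn_response -/(nn_order x) (nth_map i0)//.
by rewrite size_nn_order (leq_trans (ltn_ord i)).
Qed.

Lemma sum_nn_weight k x (f : 'I_n -> R) :
  \sum_(j < n) nn_weight k x j * f j =
  k%:R^-1 * \sum_(j in take k (nn_order x)) f j.
Proof.
rewrite mulr_sumr [RHS]big_mkcond; apply: eq_bigr => j _; rewrite /nn_weight.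
by case: ifP; rewrite ?mulr1// mulr0 mul0r.
Qed.

Lemma sum_nn_weight1 k x : (0 < k)%N -> (k <= n)%N ->
  \sum_(j < n) nn_weight k x j = 1.
Proof.
move=> k0 kn; under eq_bigr do rewrite -[nn_weight _ _ _]mulr1.
rewrite sum_nn_weight sumr_const card_take_nn_order// mulVf//.
by rewrite pnatr_eq0 -lt0n.
Qed.

End nearest_neighbors.

(** The elements common to [T] and [J] cancel. The two differences have the same size, and the
    largest value of [r] on [T :\: J] is at most every value on [J :\: T]. *)
Lemma sum_le_exchange {R : realType} (I : finType) (T J : {set I})
    (r : I -> R) :
  #|T| = #|J| -> (forall i j, i \in T -> j \notin T -> r i <= r j) ->
  \sum_(i in T) r i <= \sum_(j in J) r j.
Proof.
move=> TJ Tr.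
have cTJ : #|T :\: J| = #|J :\: T|.
  by rewrite !cardsD TJ finset.setIC.
rewrite (big_setID J) [leRHS](big_setID T)/= finset.setIC lerD2l.
have [T0|[i0 i0T]] := set_0Vmem (T :\: J)%SET.
  have J0 : (J :\: T)%SET = finset.set0.
    by apply/eqP; rewrite -cards_eq0 -cTJ T0 cards0.
  by rewrite T0 J0 !big_set0.
pose i := [arg max_(i > i0 in (T :\: J)%SET) r i]%O.
have [iT ir] : i \in (T :\: J)%SET /\
    forall j, j \in (T :\: J)%SET -> r j <= r i.
  by rewrite /i; case: arg_maxP.
apply: (@le_trans _ _ (\sum_(j in (T :\: J)%SET) r i)).
  by apply: ler_sum => j; exact: ir.
rewrite sumr_const cTJ -sumr_const; apply: ler_sum => j.
rewrite inE => /andP[jT _]; apply: Tr => //.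
by move: iT; rewrite inE => /andP[].
Qed.

(** * Disjoint blocks of the sample *)

Section blocks.
Variables (n k : nat).

Lemma block_subproof (b : 'I_k) (i : 'I_(n %/ k)) : (b * (n %/ k) + i < n)%N.
Proof.
case: b i => b bk [i im] /=.
have := leq_divM n k; nia.
Qed.

Definition block (b : 'I_k) (i : 'I_(n %/ k)) : 'I_n :=
  Ordinal (block_subproof b i).

Lemma block_inj b : injective (block b).
Proof. by move=> i j /(congr1 val)/= /addnI ij; apply/val_inj. Qed.

Lemma block_disjoint b1 b2 i1 i2 : block b1 i1 = block b2 i2 -> b1 = b2.
Proof.
move=> /(congr1 val)/= bi; apply/val_inj => /=.
have m0 : (0 < n %/ k)%N by rewrite (leq_ltn_trans _ (ltn_ord i1)).
have := congr1 (fun t => t %/ (n %/ k))%N bi.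
by rewrite /= !divnMDl// !divn_small// !addn0.
Qed.

End blocks.

(** Whatever point [f] picks in each block, disjointness makes the picks [k] distinct sample points,
    and no [k] points are closer to [x] in total than the [k] nearest ones. *)
Lemma sum_nearest_le_blocks {R : realType} (d n k : nat)
    (D : n.-tuple (d.-tuple R * R)) (s : 'S_n) (x : d.-tuple R)
    (f : 'I_k -> 'I_(n %/ k)) (g : R -> R) :
  (k <= n)%N -> {in Num.nneg &, {homo g : u v / u <= v}} ->
  \sum_(j in take k (nn_order D s x)) g (eucl_dist (tnth D j).1 x) <=
  \sum_(b < k) g (eucl_dist (tnth D (block b (f b))).1 x).
Proof.
move=> kn g_homo; pose r j := g (eucl_dist (tnth D j).1 x).
pose T := [set j in take k (nn_order D s x)]%SET.
pose J := [set block b (f b) | b : 'I_k]%SET.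
have finj : injective (fun b => block b (f b)) by move=> b c /block_disjoint.
have -> : \sum_(j in take k (nn_order D s x)) g (eucl_dist (tnth D j).1 x) =
          \sum_(j in T) r j.
  by apply: eq_bigl => j; rewrite inE.
have -> : \sum_(b < k) g (eucl_dist (tnth D (block b (f b))).1 x) =
          \sum_(j in J) r j.
  by rewrite big_imset//= => b c _ _; exact: finj.
apply: sum_le_exchange.
  by rewrite cardsE card_take_nn_order// card_imset// card_ord.
move=> i j; rewrite !inE => iT jT.
by apply: g_homo (take_nn_order_le iT jT); rewrite nnegrE eucl_dist_ge0.
Qed.

Section finite_factor.
Context d (T : measurableType d) (R : realType).

Lemma measurable_natr_bool (b : T -> bool) :
  measurable_fun setT b -> measurable_fun setT (fun t => (b t)%:R : R).
Proof.
by move=> mb; apply: (measurableT_comp (f := fun c : bool => c%:R : R)) => // _ Y _.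
Qed.

(** A preimage is a finite union, over the admissible truth tables, of finite intersections of
    measurable sets. This serves for the neighbor weights, which see the covariates only through
    pairwise comparisons of distances. *)
Lemma measurable_finite_factor (I : finType) (b : I -> T -> bool)
    (phi : {ffun I -> bool} -> R) :
  (forall i, measurable_fun setT (b i)) ->
  measurable_fun setT (fun t => phi [ffun i => b i t]).
Proof.
move=> mb _ Y mY; rewrite setTI.
rewrite (_ : _ @^-1` _ = \bigcup_(r in [set r | Y (phi r)])
    \bigcap_(i in [set: I]) (b i @^-1` [set r i])).
  apply: fin_bigcup_measurable => [|r _]; first exact: finite_finset.
  apply: fin_bigcap_measurable => // i _.
  by rewrite -[X in measurable X]setTI; exact: mb.
apply/seteqP; split => [t Yt|t [r Yr rt]] /=.
  by exists [ffun i => b i t] => // i _ /=; rewrite ffunE.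
rewrite (_ : [ffun i => b i t] = r)//.
by apply/ffunP => i; rewrite ffunE; exact: rt.
Qed.

End finite_factor.

(** Cauchy-Schwarz against the constant [1]: sum the tangent inequality [2 m x - m^2 <= x^2] at the
    mean [m]. *)
Lemma sqr_sum_le {R : realType} (I : finType) (p : {pred I}) (x : I -> R) :
  (\sum_(i in p) x i) ^+ 2 <= #|p|%:R * \sum_(i in p) x i ^+ 2.
Proof.
have [p0|p0] := posnP #|p|.
  rewrite p0 mul0r big_pred0 ?expr0n// => i; exact: (card0_eq p0).
have k0 : 0 < #|p|%:R :> R by rewrite ltr0n.
set S := \sum_(i in p) x i; pose m := S / #|p|%:R.
have : \sum_(i in p) (2 * m * x i - m ^+ 2) <= \sum_(i in p) x i ^+ 2.
  apply: ler_sum => i _; rewrite -subr_ge0.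
  by rewrite (_ : _ - _ = (x i - m) ^+ 2) ?sqr_ge0//; ring.
rewrite big_split/= -mulr_sumr sumr_const -/S -[X in _ + X]mulr_natr.
rewrite -(ler_pM2l k0); apply: le_trans.
by rewrite le_eqVlt /m; apply/orP; left; apply/eqP; field; rewrite gt_eqF.
Qed.

(** * Product measures *)

Section mpow_theory.
Context d (T : measurableType d) (R : realType).
Implicit Type mu : {sigma_finite_measure set T -> \bar R}.
Local Open Scope ereal_scope.

Lemma measurable_mktuple d1 (T1 : measurableType d1) n (f : 'I_n -> T1 -> T) :
  (forall i, measurable_fun setT (f i)) ->
  measurable_fun setT (fun x => [tuple f i x | i < n]).
Proof.
move=> mf; apply/measurable_fun_tnthP => i.
rewrite (_ : _ \o _ = f i)//; apply/funext => x /=; exact: tnth_mktuple.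
Qed.

Lemma ge0_integral_mpow_cons mu n (G : n.+1.-tuple T -> \bar R) :
  measurable_fun setT G -> (forall u, 0 <= G u) ->
  \int[mpow mu n.+1]_u G u = \int[mu]_x \int[mpow mu n]_t G (tcons (x, t)).
Proof.
move=> mG G0.
rewrite [LHS](ge0_integral_pushforward (@measurable_tcons _ T n)
  [the measure _ _ of mu \x mpow mu n])//=.
rewrite preimage_setT fubini_tonelli1//=.
exact: measurableT_comp mG (@measurable_tcons _ _ _).
Qed.

Lemma integral_mpow0 mu (G : 0.-tuple T -> \bar R) :
  measurable_fun setT G -> \int[mpow mu 0]_u G u = G [tuple].
Proof. by move=> mG; rewrite integral_dirac// diracT mul1e. Qed.

Lemma ge0_integral_mpow_rcons mu n (G : n.+1.-tuple T -> \bar R) :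
  measurable_fun setT G -> (forall u, 0 <= G u) ->
  \int[mpow mu n.+1]_u G u = \int[mpow mu n]_t \int[mu]_x G (tcons (x, t)).
Proof.
move=> mG G0; rewrite ge0_integral_mpow_cons//.
rewrite (fubini_tonelli (G \o @tcons _ T n)) => [//||].
  exact: measurableT_comp mG (@measurable_tcons _ _ _).
by move=> w; exact: G0.
Qed.

Definition tuple_insert n (j : 'I_n.+1) (p : T * n.-tuple T) : n.+1.-tuple T :=
  [tuple if unlift j i is Some i' then tnth p.2 i' else p.1 | i < n.+1].

Lemma tnth_insert n (j : 'I_n.+1) p : tnth (tuple_insert j p) j = p.1.
Proof. by rewrite tnth_mktuple unlift_none. Qed.

Lemma tnth_insert_lift n (j : 'I_n.+1) p i :
  tnth (tuple_insert j p) (lift j i) = tnth p.2 i.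
Proof. by rewrite tnth_mktuple liftK. Qed.

Lemma measurable_tuple_insert n (j : 'I_n.+1) :
  measurable_fun setT (tuple_insert j).
Proof.
apply: measurable_mktuple => i.
case: unliftP => [i' _|_]; last exact: measurable_fst.
exact: (measurableT_comp (measurable_tnth i')).
Qed.

Lemma tuple_insert0 n (p : T * n.-tuple T) : tuple_insert ord0 p = tcons p.
Proof.
apply: eq_from_tnth => i; case: (unliftP ord0 i) => [i' ->|->].
  by rewrite tnth_insert_lift /tcons tnthS; congr (tnth _ _).
by rewrite tnth_insert.
Qed.

Lemma tuple_insert_tcons n (j : 'I_n.+1) (p q : T) (t : n.-tuple T) :
  tcons (q, tuple_insert j (p, t)) =
  tuple_insert (lift ord0 j) (p, tcons (q, t)).
Proof.
apply: eq_from_tnth => i; case: (unliftP ord0 i) => [{}i ->|->].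
  rewrite /tcons tnthS/=; case: (unliftP j i) => [{}i ->|->].
    rewrite tnth_insert_lift.
    rewrite (_ : lift ord0 (lift j i) = lift (lift ord0 j) (lift ord0 i)).
      by rewrite tnth_insert_lift/= tnthS.
    by apply/val_inj; rewrite /= /bump/=; lia.
  by rewrite !tnth_insert.
rewrite (_ : ord0 = lift (lift ord0 j) ord0) ?tnth_insert_lift//.
exact/val_inj.
Qed.

(** Any coordinate [j] may be integrated outermost. In the induction the first coordinate is split
    off, the hypothesis brings the inserted one out of the rest, and Tonelli swaps the two single
    integrals. *)
Lemma ge0_integral_mpow_insert mu n (j : 'I_n.+1)
    (G : n.+1.-tuple T -> \bar R) :
  measurable_fun setT G -> (forall u, 0 <= G u) ->
  \int[mpow mu n.+1]_u G u =
  \int[mu]_x \int[mpow mu n]_t G (tuple_insert j (x, t)).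
Proof.
elim: n j G => [|n IH] j G mG G0.
  rewrite (ord1 j) (ge0_integral_mpow_cons _ mG G0).
  by under [RHS]eq_integral do under eq_integral do rewrite tuple_insert0.
case: (unliftP ord0 j) => [{}j ->|->]; last first.
  rewrite (ge0_integral_mpow_cons _ mG G0).
  by under [RHS]eq_integral do under eq_integral do rewrite tuple_insert0.
rewrite (ge0_integral_mpow_cons _ mG G0).
have mins : measurable_fun setT (fun w : T * T * n.-tuple T =>
    tcons (w.1.1, tuple_insert j (w.1.2, w.2))).
  apply: (measurable_cons (f := fun w => w.1.1)).
    exact: measurableT_comp.
  apply: (measurableT_comp (measurable_tuple_insert j)).
  by apply: measurable_fun_pair => //; exact: measurableT_comp.
under eq_integral => q _.
  rewrite (IH j)//; last first.
    apply: (measurableT_comp mG).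
    by apply: (measurableT_comp (@measurable_tcons _ _ _)); exact: measurable_fun_pair.
  over.
rewrite (fubini_tonelli (fun w : T * T =>
  \int[mpow mu n]_t G (tcons (w.1, tuple_insert j (w.2, t)))))/=; last 2 first.
- apply: (@measurable_fun_fubini_tonelli_F _ _ _ _ _ (mpow mu n)
    (fun w : T * T * n.-tuple T =>
      G (tcons (w.1.1, tuple_insert j (w.1.2, w.2))))) => //.
  exact: measurableT_comp mG mins.
- by move=> w; exact: integral_ge0.
have mGins p :
    measurable_fun setT (fun t => G (tuple_insert (lift ord0 j) (p, t))).
  apply: (measurableT_comp mG).
  apply: (measurableT_comp (measurable_tuple_insert _)).
  exact: measurable_fun_pair.
apply: eq_integral => p _.
rewrite (ge0_integral_mpow_cons _ (mGins p)) => [|u]; last exact: G0.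
by under eq_integral do under eq_integral do rewrite tuple_insert_tcons.
Qed.

End mpow_theory.

Section mpow_probability.
Context d (T : measurableType d) (R : realType) (P : probability T R).
Local Open Scope ereal_scope.

Lemma mpow_setT n : mpow P n setT = 1.
Proof.
rewrite (_ : setT = [set t : n.-tuple T | forall i : 'I_n, setT (tnth t i)]).
  by rewrite (mpow_box P (A := fun=> setT))// big1// => i _; exact: probability_setT.
by apply/seteqP; split.
Qed.

(** Distinct coordinates of an i.i.d. sample are again an i.i.d. sample. A permutation [f] gives
    exchangeability, and a non-surjective [f] gives the law of a subsample; both uses occur
    below. *)
Lemma ge0_integral_mpow_marginal m n (f : 'I_m -> 'I_n)
    (G : m.-tuple T -> \bar R) :
  injective f -> measurable_fun setT G -> (forall u, 0 <= G u) ->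
  \int[mpow P n]_u G [tuple tnth u (f i) | i < m] = \int[mpow P m]_u G u.
Proof.
elim: m n f G => [|m IH] n f G f_inj mG G0.
  under eq_integral do rewrite tuple0.
  by rewrite integral_cst// [X in _ * X = _](mpow_setT n) mule1 integral_mpow0.
case: n f f_inj => [f|n f f_inj]; first by case: (f ord0).
have f_neq i : f (lift ord0 i) != f ord0.
  by rewrite (inj_eq f_inj) eq_sym neq_lift.
(* By injectivity the remaining indices avoid [f ord0], so they are indices [f'] into the tuple left
   after that coordinate is integrated. *)
have [f' f'E] : {f' : 'I_m -> 'I_n &
    forall i, f (lift ord0 i) = lift (f ord0) (f' i)}.
  apply: (boolp.choice (P := fun i k => f (lift ord0 i) = lift (f ord0) k)) => i.
  case: (unliftP (f ord0) (f (lift ord0 i))) => [k ->|]; first by exists k.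
  by move/eqP; rewrite (negbTE (f_neq i)).
rewrite (ge0_integral_mpow_insert _ (f ord0))//; last first.
  apply: (measurableT_comp mG); apply: measurable_mktuple => i.
  exact: measurable_tnth.
rewrite ge0_integral_mpow_cons//; apply: eq_integral => x _.
rewrite -(IH _ f')//; last first.
- apply: (measurableT_comp mG); apply: (measurableT_comp (@measurable_tcons _ _ _)).
  exact: measurable_fun_pair.
- move=> i k ik; apply/(@lift_inj _ ord0)/f_inj; by rewrite !f'E ik.
apply: eq_integral => t _; congr G; apply: eq_from_tnth => i.
rewrite tnth_mktuple; case: (unliftP ord0 i) => [{}i ->|->].
  by rewrite f'E tnth_insert_lift /tcons tnthS tnth_mktuple.
by rewrite tnth_insert.
Qed.

End mpow_probability.

(** * Conditional distribution functions *)

Section weighted_integral.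
Context d1 d2 (T : measurableType d1) (U : measurableType d2) (R : realType).
Variables (mu : {measure set T -> \bar R}) (q : T -> U).
Hypothesis mq : measurable_fun setT q.
Local Open Scope ereal_scope.

Import HBNNSimple.

Lemma ge0_integral_comp_mul (f : T -> R) (phi : U -> \bar R)
    (mphi : measurable_fun setT phi) :
  measurable_fun setT f -> (forall t, 0 <= f t)%R -> (forall u, 0 <= phi u) ->
  let g := nnsfun_approx measurableT mphi in
  \int[mu]_t (phi (q t) * (f t)%:E) =
  limn (fun n => \sum_(r \in range (g n))
    (r%:E * \int[mu]_(t in q @^-1` (g n @^-1` [set r])) (f t)%:E)).
Proof.
move=> mf f0 phi0 g.
have mqA A : measurable A -> measurable (q @^-1` A).
  by move=> mA; rewrite -[_ @^-1` _]setTI; exact: mq.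
have mEf : measurable_fun setT (EFin \o f) by exact/measurable_EFinP.
have mgq n : measurable_fun setT (fun t => (g n (q t))%:E).
  apply/measurable_EFinP; apply: (measurableT_comp _ mq).
  exact: measurable_funP.
transitivity (limn (fun n => \int[mu]_t ((g n (q t))%:E * (f t)%:E))).
  rewrite -monotone_convergence//.
  - apply: eq_integral => t _; apply/esym/cvg_lim => //.
    apply: cvgeZr => //; apply: (cvg_nnsfun_approx measurableT mphi) => // u _.
  - move=> n; exact: emeasurable_funM.
  - by move=> n t _; rewrite mule_ge0// lee_fin.
  - move=> t _ m n mn; rewrite lee_wpmul2r ?lee_fin//.
    exact/lefP/nd_nnsfun_approx.
congr (limn _); apply/funext => n.
transitivity (\int[mu]_t \sum_(r \in range (g n))
    (r%:E * ((\1_(q @^-1` (g n @^-1` [set r])) t)%:E * (f t)%:E))).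
  apply: eq_integral => t _; rewrite fimfunE -fsumEFin// ge0_mule_fsuml//.
    by apply: eq_fsbigr => r _; rewrite EFinM muleA.
  by move=> r; rewrite nnfun_muleindic_ge0.
have mind r : measurable (q @^-1` (g n @^-1` [set r])) by apply: mqA.
have mterm r : measurable_fun setT
    (fun t => (\1_(q @^-1` (g n @^-1` [set r])) t)%:E * (f t)%:E).
  apply: emeasurable_funM => //; apply/measurable_EFinP; exact: measurable_indic.
have term0 r t : 0 <= (\1_(q @^-1` (g n @^-1` [set r])) t)%:E * (f t)%:E.
  by rewrite mule_ge0// lee_fin.
rewrite ge0_integral_fsum//; last 2 first.
- by move=> r; exact: measurable_funeM.
- move=> r t _; rewrite muleA mule_ge0 ?lee_fin//.
  exact: (nnfun_muleindic_ge0 (g n)).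
apply: eq_fsbigr => r /[!inE] -[u _ <-].
rewrite ge0_integralZl_EFin//; congr (_ * _).
rewrite [RHS]integral_mkcond; apply: eq_integral => t _.
by rewrite patchE indicE; case: ifP; rewrite ?mul1e ?mul0e.
Qed.

(** With [q := fst], this extends the defining property of a conditional distribution function from
    events of the covariate to nonnegative functions of it. *)
Lemma ge0_eq_integral_comp_mul (f1 f2 : T -> R) :
  measurable_fun setT f1 -> (forall t, 0 <= f1 t)%R ->
  measurable_fun setT f2 -> (forall t, 0 <= f2 t)%R ->
  (forall A, measurable A -> \int[mu]_(t in q @^-1` A) (f1 t)%:E =
    \int[mu]_(t in q @^-1` A) (f2 t)%:E) ->
  forall phi : U -> \bar R, measurable_fun setT phi -> (forall u, 0 <= phi u) ->
  \int[mu]_t (phi (q t) * (f1 t)%:E) = \int[mu]_t (phi (q t) * (f2 t)%:E).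
Proof.
move=> mf1 f10 mf2 f20 f12 phi mphi phi0.
rewrite !(ge0_integral_comp_mul mphi)//; congr (limn _); apply/funext => n.
by apply: eq_fsbigr => r _; rewrite f12.
Qed.

End weighted_integral.

Section cumulative_bounded.
Context {R : realType}.

Lemma cumulativeBounded_ge0 (F : cumulativeBounded (0 : R) (1 : R)) z :
  0 <= F z.
Proof.
have cF := cumulativeNy F; apply: (cvgr_to_le cF).
near=> t; apply: (cumulative_is_nondecreasing F).
by near: t; exact: nbhs_ninfty_le.
Unshelve. all: by end_near. Qed.

Lemma cumulativeBounded_le1 (F : cumulativeBounded (0 : R) (1 : R)) z :
  F z <= 1.
Proof.
have cF := cumulativey F; apply: (cvgr_to_ge cF).
near=> t; apply: (cumulative_is_nondecreasing F).
by near: t; exact: nbhs_pinfty_ge.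
Unshelve. all: by end_near. Qed.

(* By right continuity, [F x z < a] iff [F x q < a] for some rational [q > z]. *)
Lemma measurable_cumulative_uncurry d (T : measurableType d)
    (F : T -> cumulativeBounded (0 : R) (1 : R)) :
  (forall z, measurable_fun setT (fun x => F x z)) ->
  measurable_fun setT (fun p : T * R => F p.1 p.2).
Proof.
move=> mF.
have mq q a : measurable [set p : T * R | p.2 < ratr q /\ F p.1 (ratr q) < a].
  rewrite (_ : [set _ | _] =
      (fun x => F x (ratr q)) @^-1` `]-oo, a[ `*` `]-oo, (ratr q : R)[);
      last first.
    by apply/seteqP; split => -[x z]; rewrite /= !in_itv/= => -[].
  apply: measurableX => //; rewrite -[_ @^-1` _]setTI; exact: mF.
apply: (measurability (@RGenCInfty.G R)) => [|_ [_ [a ->] <-]].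
  exact: RGenCInfty.measurableE.
rewrite setTI -setCitvl preimage_setC; apply: measurableC.
rewrite [X in measurable X](_ : _ =
    \bigcup_q [set p : T * R | p.2 < ratr q /\ F p.1 (ratr q) < a]); last first.
  apply/seteqP; split => [[x z]|[x z] [q _ /= [zq]]]; rewrite /= in_itv/=.
    move=> Fa; have e0 : 0 < (a - F x z) / 2 by rewrite divr_gt0// subr_gt0.
    have [e Fe] := nondecreasing_right_continuousP z (F x) e0.
    have /rat_in_itvoo[q] : z < z + e%:num by rewrite ltrDl.
    rewrite in_itv/= => /andP[zq qe]; exists q => //; split => //.
    apply: le_lt_trans (cumulative_is_nondecreasing (F x) _ _ (ltW qe)) _.
    apply: le_lt_trans Fe _; rewrite -ltrBrDl ltr_pdivrMr//.
    by rewrite ltr_pMr ?subr_gt0// ltr1n.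
  exact: le_lt_trans (cumulative_is_nondecreasing (F x) _ _ (ltW zq)).
exact: bigcupT_measurable_rat.
Qed.

End cumulative_bounded.

Section conditional_cdf.
Context {R : realType} (d : nat).
Variables (P : probability (d.-tuple R * R)%type R).
Variable F : d.-tuple R -> cumulativeBounded (0 : R) (1 : R).
Hypothesis hF : is_cond_cdf P F.
Local Notation X := (d.-tuple R).
Local Open Scope ereal_scope.

Let mF : measurable_fun setT (fun p : X * R => F p.1 p.2).
Proof. exact: measurable_cumulative_uncurry hF.1. Qed.

Let mFz z : measurable_fun setT (fun p : X * R => F p.1 z).
Proof. by apply: (measurableT_comp (hF.1 z)). Qed.

Lemma le_indicatorE z (p : X * R) :
  ((p.2 <= z)%R%:R : R) = \1_(snd @^-1` `]-oo, z]) p.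
Proof.
rewrite indicE; congr (_ _); congr (nat_of_bool _).
by apply/idP/idP; rewrite inE/= in_itv/=.
Qed.

Lemma measurable_le_indicator z :
  measurable_fun setT (fun p : X * R => (p.2 <= z)%R%:R : R).
Proof.
rewrite (_ : (fun _ => _) = \1_(snd @^-1` `]-oo, z])).
  by apply: measurable_indic; rewrite -[_ @^-1` _]setTI; exact: measurable_snd.
by apply/funext => p; exact: le_indicatorE.
Qed.

Lemma integral_cond_cdf z A : measurable A ->
  \int[P]_(p in fst @^-1` A) ((p.2 <= z)%R%:R)%:E =
  \int[P]_(p in fst @^-1` A) (F p.1 z)%:E.
Proof.
move=> mA.
have mfA : measurable (fst @^-1` A : set (X * R)).
  by rewrite -[_ @^-1` _]setTI; exact: measurable_fst.
transitivity (P (A `*` `]-oo, z])).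
  transitivity (\int[P]_(p in fst @^-1` A) (\1_(snd @^-1` `]-oo, z]) p)%:E).
    by apply: eq_integral => p _; rewrite le_indicatorE.
  rewrite integral_indic//; last first.
    by rewrite -[_ @^-1` _]setTI; exact: measurable_snd.
  by congr (P _); apply/seteqP; split => p /= [].
rewrite hF.2// /distribution ge0_integral_pushforward//.
- apply/measurable_EFinP; apply: measurable_funTS; exact: hF.1.
- by move=> x _; rewrite lee_fin cumulativeBounded_ge0.
Qed.

Lemma ge0_integral_cond_cdf z (phi : X -> \bar R) :
  measurable_fun setT phi -> (forall x, 0 <= phi x) ->
  \int[P]_p (phi p.1 * ((p.2 <= z)%R%:R)%:E) =
  \int[P]_p (phi p.1 * (F p.1 z)%:E).
Proof.
move=> mphi phi0.
apply: (ge0_eq_integral_comp_mul (q := fst)) => //.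
- exact: measurable_le_indicator.
- by move=> p; exact: cumulativeBounded_ge0.
- exact: integral_cond_cdf.
Qed.

(** The complementary event is treated too, so that a squared error can be split over [Y <= z] and
    [z < Y] into nonnegative parts, without integrability conditions. *)
Lemma ge0_integral_cond_cdfC z (phi : X -> \bar R) :
  measurable_fun setT phi -> (forall x, 0 <= phi x) ->
  \int[P]_p (phi p.1 * (1 - (p.2 <= z)%R%:R)%:E) =
  \int[P]_p (phi p.1 * (1 - F p.1 z)%:E).
Proof.
move=> mphi phi0.
have m1 : measurable_fun setT (fun p : X * R => (1 - (p.2 <= z)%R%:R)%R : R).
  by apply: measurable_funB => //; exact: measurable_le_indicator.
have m2 : measurable_fun setT (fun p : X * R => (1 - F p.1 z)%R).
  exact: measurable_funB.
have p1 (p : X * R) : (0 <= 1 - (p.2 <= z)%R%:R :> R)%R.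
  by rewrite subr_ge0 lern1 leq_b1.
have p2 (p : X * R) : (0 <= 1 - F p.1 z)%R.
  by rewrite subr_ge0 cumulativeBounded_le1.
apply: (ge0_eq_integral_comp_mul (q := fst)) => // A mA.
have mfA : measurable (fst @^-1` A : set (X * R)).
  by rewrite -[_ @^-1` _]setTI; exact: measurable_fst.
have fin : \int[P]_(p in fst @^-1` A) (F p.1 z)%:E \is a fin_num.
  rewrite ge0_fin_numE; last first.
    by apply: integral_ge0 => p _; rewrite lee_fin cumulativeBounded_ge0.
  apply: (@le_lt_trans _ _ (\int[P]_(p in fst @^-1` A) 1)).
    apply: ge0_le_integral => //.
    - by move=> p _; rewrite lee_fin cumulativeBounded_ge0.
    - by apply/measurable_EFinP; exact: measurable_funTS.
    - by move=> p _; rewrite lee_fin cumulativeBounded_le1.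
  rewrite integral_cst// mul1e; exact: le_lt_trans (probability_le1 _ _) (ltry _).
(* Adding the finite integral of [F], which is also that of the indicator, turns both sides into the
   integral of [1]. *)
rewrite -[LHS](addeK _ fin) -[RHS](addeK _ fin); congr (_ - _).
rewrite -{1}integral_cond_cdf// -!ge0_integralD//.
- by apply: eq_integral => p _; rewrite -!EFinD !subrK.
- by move=> p _; rewrite lee_fin.
- by apply/measurable_EFinP; exact: measurable_funTS.
- by move=> p _; rewrite lee_fin cumulativeBounded_ge0.
- by apply/measurable_EFinP; exact: measurable_funTS.
- by move=> p _; rewrite lee_fin.
- by apply/measurable_EFinP; exact: measurable_funTS.
- by apply/measurable_EFinP/measurable_funTS; exact: measurable_le_indicator.
Qed.

(** Second moment is squared mean plus variance, for one response. The indicator takes the values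
    [0] and [1], so the integrand is [phi1] on [Y <= z] and [phi0] elsewhere; replacing the
    indicator by [F] and expanding gives the right side. The term [c] will carry variances collected
    from other points. *)
Lemma integral_sqr_cond_cdf z (w a c : X -> R) :
  measurable_fun setT w -> measurable_fun setT a -> measurable_fun setT c ->
  (forall x, 0 <= c x)%R ->
  \int[P]_p ((w p.1 * (p.2 <= z)%R%:R + a p.1) ^+ 2 + c p.1)%:E =
  \int[P]_p ((w p.1 * F p.1 z + a p.1) ^+ 2 +
    w p.1 ^+ 2 * (F p.1 z * (1 - F p.1 z)) + c p.1)%:E.
Proof.
move=> mw ma mc c0.
pose phi1 x := (((w x + a x) ^+ 2 + c x)%R)%:E.
pose phi0 x := ((a x ^+ 2 + c x)%R)%:E.
have mphi1 : measurable_fun setT phi1.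
  apply/measurable_EFinP; apply: measurable_funD => //.
  by apply: measurable_funX; exact: measurable_funD.
have mphi0 : measurable_fun setT phi0.
  by apply/measurable_EFinP; apply: measurable_funD => //; exact: measurable_funX.
have phi1_ge0 x : 0 <= phi1 x by rewrite lee_fin addr_ge0// sqr_ge0.
have phi0_ge0 x : 0 <= phi0 x by rewrite lee_fin addr_ge0// sqr_ge0.
transitivity (\int[P]_p (phi1 p.1 * ((p.2 <= z)%R%:R)%:E +
                         phi0 p.1 * (1 - (p.2 <= z)%R%:R)%:E)).
  apply: eq_integral => p _; rewrite -!EFinM -EFinD; congr EFin.
  by case: (_ <= _)%R => /=; ring.
have mfst (f : X -> \bar R) : measurable_fun setT f ->
    measurable_fun setT (fun p : X * R => f p.1).
  by move=> mf; exact: (measurableT_comp mf).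
have B0 (p : X * R) : (0 <= 1 - F p.1 z)%R.
  by rewrite subr_ge0 cumulativeBounded_le1.
rewrite ge0_integralD//; last 4 first.
- by move=> p _; rewrite mule_ge0.
- apply: emeasurable_funM; first exact: mfst.
  by apply/measurable_EFinP; exact: measurable_le_indicator.
- by move=> p _; rewrite mule_ge0// lee_fin subr_ge0 lern1 leq_b1.
- apply: emeasurable_funM; first exact: mfst.
  apply/measurable_EFinP; apply: measurable_funB => //.
  exact: measurable_le_indicator.
rewrite ge0_integral_cond_cdf// ge0_integral_cond_cdfC// -ge0_integralD//.
- apply: eq_integral => p _; rewrite -!EFinM -EFinD; congr EFin; ring.
- by move=> p _; rewrite mule_ge0// lee_fin cumulativeBounded_ge0.
- apply: emeasurable_funM; first exact: mfst.
  exact/measurable_EFinP.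
- by move=> p _; apply: mule_ge0 => //; rewrite lee_fin; exact: B0.
- apply: emeasurable_funM; first exact: mfst.
  by apply/measurable_EFinP; exact: measurable_funB.
Qed.

End conditional_cdf.

(** * Bias-variance decomposition given the covariates *)

Section bias_variance.
Context {R : realType} (d : nat).
Variables (P : probability (d.-tuple R * R)%type R).
Variable F : d.-tuple R -> cumulativeBounded (0 : R) (1 : R).
Hypothesis hF : is_cond_cdf P F.
Local Notation X := (d.-tuple R).

Definition covariates n (u : n.-tuple (X * R)) : n.-tuple X :=
  [tuple (tnth u i).1 | i < n].

Lemma covariates_tcons n p (t : n.-tuple (X * R)) :
  covariates (tcons (p, t)) = tcons (p.1, covariates t).
Proof.
apply: eq_from_tnth => i; rewrite tnth_mktuple.
by case: (unliftP ord0 i) => [{}i ->|->//]; rewrite /tcons !tnthS tnth_mktuple.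
Qed.

Lemma measurable_covariates n : measurable_fun setT (@covariates n).
Proof.
apply: measurable_mktuple => i.
exact: (measurableT_comp measurable_fst (measurable_tnth i)).
Qed.

(** Each weight may depend on all the covariates but on no response, so that only the indicators
    remain random once the covariates are given. *)
Definition noise_sum n (w : 'I_n -> n.-tuple X -> R) z
    (u : n.-tuple (X * R)) : R :=
  \sum_(i < n) w i (covariates u) * ((tnth u i).2 <= z)%R%:R.

(** The conditional mean of [noise_sum] given the covariates. *)
Definition mean_sum n (w : 'I_n -> n.-tuple X -> R) z
    (u : n.-tuple (X * R)) : R :=
  \sum_(i < n) w i (covariates u) * F (tnth u i).1 z.

(** The conditional variance of [noise_sum] given the covariates: the responses are conditionally
    independent, and an indicator of mean [F] has variance [F (1 - F)]. *)
Definition variance_sum n (w : 'I_n -> n.-tuple X -> R) z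
    (u : n.-tuple (X * R)) : R :=
  \sum_(i < n) w i (covariates u) ^+ 2 *
    (F (tnth u i).1 z * (1 - F (tnth u i).1 z)).

Section measurability.
Variables (n : nat) (w : 'I_n -> n.-tuple X -> R).
Hypothesis mw : forall i, measurable_fun setT (w i).
Let T := n.-tuple (X * R).

Let mX i : measurable_fun setT (fun q : T * R => (tnth q.1 i).1).
Proof.
apply: (measurableT_comp measurable_fst).
exact: (measurableT_comp (measurable_tnth i) measurable_fst).
Qed.

Let mwX i : measurable_fun setT (fun q : T * R => w i (covariates q.1)).
Proof.
apply: (measurableT_comp (mw i)).
exact: (measurableT_comp (@measurable_covariates n) measurable_fst).
Qed.

Let mF i : measurable_fun setT (fun q : T * R => F (tnth q.1 i).1 q.2).
Proof.
apply: (measurableT_comp (g := fun q : T * R => ((tnth q.1 i).1, q.2))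
  (measurable_cumulative_uncurry hF.1)).
exact: measurable_fun_pair.
Qed.

Lemma measurable_noise_sum :
  measurable_fun setT (fun q : T * R => noise_sum w q.2 q.1).
Proof.
apply: measurable_sum => i; apply: measurable_funM => //.
apply: measurable_natr_bool; apply: measurable_fun_ler => //.
apply: (measurableT_comp measurable_snd).
exact: (measurableT_comp (measurable_tnth i) measurable_fst).
Qed.

Lemma measurable_mean_sum :
  measurable_fun setT (fun q : T * R => mean_sum w q.2 q.1).
Proof. by apply: measurable_sum => i; exact: measurable_funM. Qed.

Lemma measurable_variance_sum :
  measurable_fun setT (fun q : T * R => variance_sum w q.2 q.1).
Proof.
apply: measurable_sum => i; apply: measurable_funM.
  exact: measurable_funX.
by apply: measurable_funM => //; exact: measurable_funB.
Qed.

Lemma variance_sum_ge0 z u : 0 <= variance_sum w z u.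
Proof.
apply: sumr_ge0 => i _; rewrite mulr_ge0 ?sqr_ge0// mulr_ge0//.
  exact: cumulativeBounded_ge0.
by rewrite subr_ge0 cumulativeBounded_le1.
Qed.

End measurability.

Lemma sum_tcons n (w : 'I_n.+1 -> n.+1.-tuple X -> R) (f : X * R -> R)
    p (t : n.-tuple (X * R)) :
  \sum_(i < n.+1) w i (covariates (tcons (p, t))) * f (tnth (tcons (p, t)) i) =
  w ord0 (tcons (p.1, covariates t)) * f p +
  \sum_(i < n) w (lift ord0 i) (tcons (p.1, covariates t)) * f (tnth t i).
Proof.
rewrite big_ord_recl covariates_tcons; congr (_ + _).
by apply: eq_bigr => i _; rewrite /tcons tnthS.
Qed.

Local Open Scope ereal_scope.

(** The responses are averaged out one point at a time, by induction on [n], which replaces any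
    appeal to conditional laws. The arbitrary shift [a] is there for the induction: it absorbs the
    term of the point currently held fixed. *)
Lemma integral_mpow_sqr_cond_cdf z n (w : 'I_n -> n.-tuple X -> R)
    (a : n.-tuple X -> R) :
  (forall i, measurable_fun setT (w i)) -> measurable_fun setT a ->
  \int[mpow P n]_u ((noise_sum w z u + a (covariates u)) ^+ 2)%:E =
  \int[mpow P n]_u
    ((mean_sum w z u + a (covariates u)) ^+ 2 + variance_sum w z u)%:E.
Proof.
have mpair d1 (S : measurableType d1) (f : S * R -> R) :
    measurable_fun setT f -> measurable_fun setT (fun s => f (s, z)).
  by move=> mf; apply: (measurableT_comp mf); exact: measurable_fun_pair.
have mN m (v : 'I_m -> m.-tuple X -> R) :
    (forall i, measurable_fun setT (v i)) ->
    measurable_fun setT (noise_sum v z).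
  by move=> mv; exact: (mpair _ _ _ (measurable_noise_sum mv)).
have mM m (v : 'I_m -> m.-tuple X -> R) :
    (forall i, measurable_fun setT (v i)) ->
    measurable_fun setT (mean_sum v z).
  by move=> mv; exact: (mpair _ _ _ (measurable_mean_sum mv)).
have mV m (v : 'I_m -> m.-tuple X -> R) :
    (forall i, measurable_fun setT (v i)) ->
    measurable_fun setT (variance_sum v z).
  by move=> mv; exact: (mpair _ _ _ (measurable_variance_sum mv)).
elim: n w a => [|n IH] w a mw ma.
  apply: eq_integral => u _.
  by rewrite /noise_sum /mean_sum /variance_sum !big_ord0 addr0.
have mcov (b : n.+1.-tuple X -> R) : measurable_fun setT b ->
    measurable_fun setT (fun u => b (covariates u)).
  by move=> mb; apply: (measurableT_comp mb); exact: measurable_covariates.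
pose w' (x : X) (i : 'I_n) t := w (lift ord0 i) (tcons (x, t)).
(* With the first point [(x, y)] fixed, its own term joins the shift. *)
pose b y x t := (w ord0 (tcons (x, t)) * (y <= z)%R%:R + a (tcons (x, t)))%R.
have mtc x : measurable_fun setT (fun t : n.-tuple X => tcons (x, t)).
  by apply: (measurableT_comp (@measurable_tcons _ _ _)); exact: measurable_fun_pair.
pose rest (u : n.+1.-tuple (X * R)) := [tuple tnth u (lift ord0 i) | i < n].
(* The integrand once every response but the first has been averaged out. *)
pose G u : R := ((mean_sum (w' (tnth u ord0).1) z (rest u) +
    b (tnth u ord0).2 (tnth u ord0).1 (covariates (rest u))) ^+ 2 +
  variance_sum (w' (tnth u ord0).1) z (rest u))%R.
have restK p t : rest (tcons (p, t)) = t.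
  by apply: eq_from_tnth => i; rewrite tnth_mktuple /tcons tnthS.
transitivity (\int[P]_p \int[mpow P n]_t (G (tcons (p, t)))%:E).
  rewrite ge0_integral_mpow_cons; last 2 first.
  - apply/measurable_EFinP/measurable_funX/measurable_funD; last exact: mcov.
    exact: mN.
  - by move=> u; rewrite lee_fin sqr_ge0.
  apply: eq_integral => p _.
  transitivity (\int[mpow P n]_t ((noise_sum (w' p.1) z t +
      b p.2 p.1 (covariates t)) ^+ 2)%:E).
    apply: eq_integral => t _; congr (_ ^+ 2)%:E.
    rewrite /noise_sum (sum_tcons w (fun p => (p.2 <= z)%R%:R)) covariates_tcons.
    by rewrite /b addrA; congr (_ + _)%R; rewrite addrC.
  rewrite IH; last 2 first.
  - by move=> i; apply: (measurableT_comp (mw _)).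
  - apply: measurable_funD; last exact: (measurableT_comp ma).
    by apply: measurable_funM => //; exact: (measurableT_comp (mw _)).
  by apply: eq_integral => t _; rewrite /G restK.
have GE p t : G (tcons (p, t)) =
    ((w ord0 (tcons (p.1, covariates t)) * (p.2 <= z)%R%:R +
      (mean_sum (w' p.1) z t + a (tcons (p.1, covariates t)))) ^+ 2 +
     variance_sum (w' p.1) z t)%R.
  by rewrite /G restK /b/= addrCA.
have mG : measurable_fun setT (fun q => G (tcons q)).
  (* Setting the first weight to zero turns the sums over the remaining points into sums over the
     whole tuple, whose measurability is known. *)
  pose v i u := (if i == ord0 then 0 else w i u)%R : R.
  have mv i : measurable_fun setT (v i) by rewrite /v; case: (i == ord0).
  have -> : (fun q => G (tcons q)) = (fun u => (w ord0 (covariates u) *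
      ((tnth u ord0).2 <= z)%R%:R + (mean_sum v z u + a (covariates u))) ^+ 2 +
      variance_sum v z u)%R \o @tcons _ _ n.
    apply/funext => -[p t]; rewrite GE /=; congr ((_ + (_ + _)) ^+ 2 + _)%R.
    - by rewrite covariates_tcons.
    - rewrite /mean_sum (sum_tcons v (fun p => F p.1 z)) /v eqxx mul0r add0r.
      exact: eq_bigr.
    - by rewrite covariates_tcons.
    - rewrite /variance_sum (sum_tcons (fun i u => v i u ^+ 2)%R
        (fun p => F p.1 z * (1 - F p.1 z))%R).
      by rewrite /v eqxx expr0n mul0r add0r; exact: eq_bigr.
  apply: measurableT_comp (@measurable_tcons _ _ _).
  apply: measurable_funD; last exact: mV.
  apply/measurable_funX/measurable_funD; last first.
    by apply: measurable_funD; [exact: mM|exact: mcov].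
  apply: measurable_funM; first exact: mcov.
  apply: (measurableT_comp (measurable_le_indicator (d := d) z)).
  exact: measurable_tnth.
have G0 q : (0 <= G (tcons q))%R.
  by rewrite addr_ge0 ?sqr_ge0//; exact: variance_sum_ge0.
(* The first point is moved to the innermost integral, where its response can be averaged with all
   the others fixed. *)
rewrite (fubini_tonelli (fun q => (G (tcons q))%:E)); last 2 first.
- exact/measurable_EFinP.
- by move=> q; rewrite lee_fin.
rewrite ge0_integral_mpow_rcons; last 2 first.
- apply/measurable_EFinP/measurable_funD; last exact: mV.
  by apply/measurable_funX/measurable_funD; [exact: mM|exact: mcov].
- by move=> u; rewrite lee_fin addr_ge0 ?sqr_ge0// variance_sum_ge0.
apply: eq_integral => t _.
under eq_integral do rewrite GE.
have mct (b' : n.+1.-tuple X -> R) : measurable_fun setT b' ->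
    measurable_fun setT (fun x => b' (tcons (x, covariates t))).
  move=> mb'; apply: (measurableT_comp mb').
  apply: (measurableT_comp (@measurable_tcons _ _ _)); exact: measurable_fun_pair.
rewrite (integral_sqr_cond_cdf hF z
  (w := fun x => w ord0 (tcons (x, covariates t)))
  (a := fun x => (mean_sum (w' x) z t + a (tcons (x, covariates t)))%R)
  (c := fun x => variance_sum (w' x) z t)); last 4 first.
- exact: mct.
- apply: measurable_funD; last exact: mct.
  by apply: measurable_sum => i; apply: measurable_funM => //; exact: mct.
- apply: measurable_sum => i; apply: measurable_funM => //.
  by apply: measurable_funX; exact: mct.
- by move=> x; exact: variance_sum_ge0.
apply: eq_integral => p _; congr EFin.
rewrite /mean_sum (sum_tcons w (fun p => F p.1 z)) covariates_tcons addrA.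
rewrite /variance_sum (sum_tcons (fun i u => w i u ^+ 2)%R
  (fun p => F p.1 z * (1 - F p.1 z))%R).
by rewrite [RHS]addrA.
Qed.

End bias_variance.

(** * Irreducible risk *)

Section irreducible_risk.
Context {R : realType} (d : nat).
Local Notation mu := (@lebesgue_measure R).
Variables (P : probability (d.-tuple R * R)%type R).
Variable F : d.-tuple R -> cumulativeBounded (0 : R) (1 : R).
Hypothesis hF : is_cond_cdf P F.
Local Notation X := (d.-tuple R).
Local Open Scope ereal_scope.

(** The expected CRPS of [F x] at a response drawn from [F x] itself. *)
Definition dispersion (x : X) : \bar R := \int[mu]_z (F x z * (1 - F x z))%:E.

Lemma dispersion_ge0 x : 0 <= dispersion x.
Proof.
apply: integral_ge0 => z _; rewrite lee_fin mulr_ge0 ?cumulativeBounded_ge0//.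
by rewrite subr_ge0 cumulativeBounded_le1.
Qed.

Let mF := measurable_cumulative_uncurry hF.1.

Let mFF :
  measurable_fun setT (fun q : X * R => (F q.1 q.2 * (1 - F q.1 q.2))%:E).
Proof.
by apply/measurable_EFinP/measurable_funM => //; exact: measurable_funB.
Qed.

Let FF_ge0 x z : (0 <= F x z * (1 - F x z))%R.
Proof.
rewrite mulr_ge0 ?cumulativeBounded_ge0//.
by rewrite subr_ge0 cumulativeBounded_le1.
Qed.

Lemma measurable_dispersion : measurable_fun setT dispersion.
Proof.
apply: (@measurable_fun_fubini_tonelli_F _ _ _ _ _ mu
  (fun q : X * R => (F q.1 q.2 * (1 - F q.1 q.2))%:E)) => // q.
by rewrite lee_fin.
Qed.

Definition irreducible_risk : \bar R := \int[P]_p dispersion p.1.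

Lemma irreducible_risk_ge0 : 0 <= irreducible_risk.
Proof. by apply: integral_ge0 => p _; exact: dispersion_ge0. Qed.

(** For each [z], the one-point identity with weight [-1] and shift [G x z] writes the expected
    squared error as that of [(G - F)^2 + F (1 - F)]; dropping the square and integrating in [z]
    gives the bound. It will be applied to another version of the conditional distribution
    function. *)
Lemma irreducible_risk_le (G : X -> cumulativeBounded (0 : R) (1 : R)) :
  (forall z, measurable_fun setT (fun x => G x z)) ->
  irreducible_risk <= risk P G.
Proof.
move=> mG; have mG2 := measurable_cumulative_uncurry mG.
have mfp (f : X * R -> R) : measurable_fun setT f ->
    measurable_fun setT (fun q : (X * R) * R => f (q.1.1, q.2)).
  move=> mf; apply: (measurableT_comp mf); apply: measurable_fun_pair => //.
  exact: (measurableT_comp measurable_fst).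
have mloss : measurable_fun setT (fun q : (X * R) * R =>
    ((G q.1.1 q.2 - (q.1.2 <= q.2)%R%:R) ^+ 2)%:E).
  apply/measurable_EFinP/measurable_funX/measurable_funB; first exact: (mfp _ mG2).
  apply: measurable_natr_bool; apply: measurable_fun_ler => //.
  exact: (measurableT_comp measurable_snd).
rewrite /irreducible_risk /dispersion /risk /CRPS.
have -> : \int[P]_p \int[mu]_z ((G p.1 z - (p.2 <= z)%R%:R) ^+ 2)%:E =
    \int[mu]_z \int[P]_p ((G p.1 z - (p.2 <= z)%R%:R) ^+ 2)%:E.
  apply: (@fubini_tonelli _ _ _ _ _ P mu _ mloss) => q.
  by rewrite lee_fin sqr_ge0.
have mFF' : measurable_fun setT (fun q : (X * R) * R =>
    (F q.1.1 q.2 * (1 - F q.1.1 q.2))%:E).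
  apply/measurable_EFinP; apply: (mfp (fun q => F q.1 q.2 * (1 - F q.1 q.2))%R).
  by apply: measurable_funM => //; exact: measurable_funB.
have -> : \int[P]_p \int[mu]_z (F p.1 z * (1 - F p.1 z))%:E =
    \int[mu]_z \int[P]_p (F p.1 z * (1 - F p.1 z))%:E.
  apply: (@fubini_tonelli _ _ _ _ _ P mu _ mFF') => q.
  rewrite lee_fin; exact: FF_ge0.
apply: ge0_le_integral => //.
- by move=> z _; apply: integral_ge0 => p _; rewrite lee_fin; exact: FF_ge0.
- apply: (@measurable_fun_fubini_tonelli_G _ _ _ _ _ P _ mFF') => q.
  by rewrite lee_fin; exact: FF_ge0.
- apply: (@measurable_fun_fubini_tonelli_G _ _ _ _ _ P _ mloss) => q.
  by rewrite lee_fin sqr_ge0.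
move=> z _.
have := integral_sqr_cond_cdf hF z
  (w := fun=> (-1)%R) (a := G^~ z) (c := fun=> 0%R).
move=> /(_ (measurable_cst _) (mG z) (measurable_cst _) (fun=> lexx _)) E.
rewrite [leRHS](_ : _ =
  \int[P]_p ((-1 * (p.2 <= z)%R%:R + G p.1 z) ^+ 2 + 0)%:E); last first.
  by apply: eq_integral => p _; rewrite addr0 mulN1r addrC.
have mFz : measurable_fun setT (fun p : X * R => F p.1 z).
  by apply: (measurableT_comp (hF.1 z)).
have mGz : measurable_fun setT (fun p : X * R => G p.1 z).
  by apply: (measurableT_comp (mG z)).
rewrite E; apply: ge0_le_integral => //.
- by move=> p _; rewrite lee_fin; exact: FF_ge0.
- by apply/measurable_EFinP/measurable_funM => //; exact: measurable_funB.
- apply/measurable_EFinP/measurable_funD => //; apply: measurable_funD.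
    by apply/measurable_funX/measurable_funD => //; exact: measurable_funM.
  apply: measurable_funM => //; apply: measurable_funM => //.
  exact: measurable_funB.
- by move=> p _; rewrite lee_fin addr0 sqrrN expr1n mul1r lerDr sqr_ge0.
Qed.

Lemma irreducible_risk_le_cst (M : R) :
  (0 <= M)%R -> {ae P, forall p, unit_cube d p.1} ->
  (forall x, unit_cube d x -> dispersion x <= M%:E) ->
  irreducible_risk <= M%:E.
Proof.
move=> M0 Pc FM; apply: (@le_trans _ _ (\int[P]_p M%:E)).
  apply: ae_ge0_le_integral => //.
  - by move=> p _; exact: dispersion_ge0.
  - exact: (measurableT_comp measurable_dispersion measurable_fst).
  - by apply: filterS Pc => p pc _; exact: FM.
by rewrite integral_cst// [X in _ * X](@probability_setT _ _ _ P) mule1.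
Qed.

End irreducible_risk.

(** * Packing balls in the cube *)

Section lebesgue_dilation.
Context {R : realType}.
Local Notation leb := (@lebesgue_measure R).
Local Open Scope ereal_scope.

(** The pushforward of Lebesgue measure under the affine map, scaled by [1 / r], gives each interval
    []a, b]] its length, so uniqueness of Lebesgue measure applies. *)
Lemma lebesgue_measure_affine (c r : R) A : (0 < r)%R -> measurable A ->
  leb ((fun x => (x - c) / r)%R @^-1` A) = r%:E * leb A.
Proof.
move=> r0 mA.
pose f (x : measurableTypeR R) : measurableTypeR R := ((x - c) / r)%R.
have mf : measurable_fun setT f.
  by apply: measurable_funM => //; exact: measurable_funB.
have ri0 : (0 <= r^-1)%R by rewrite invr_ge0 ltW.
suff -> : leb A = (r^-1)%:E * leb (f @^-1` A).
  by rewrite muleA -EFinM divff ?gt_eqF// mul1e.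
apply: (@lebesgue_measure_unique R (mscale (NngNum ri0)
  (measure_function_pushforward__canonical__measure_function_Measure leb mf))) => //.
move=> _ [[a b]] _ <-; rewrite /= /mscale/= /pushforward.
have -> : f @^-1` `]a, b] = `](r * a + c)%R, (r * b + c)%R]%classic.
  apply/seteqP; split => x; rewrite /f /= !in_itv/=;
    by rewrite ltr_pdivlMr// ler_pdivrMr// ltrBrDr lerBlDr ![(_ * r)%R]mulrC.
rewrite !lebesgue_measure_itv/= !lte_fin ltrD2r ltr_pM2l//.
case: ifP => _; rewrite ?mule0// -EFinD -EFinD -EFinM; congr EFin.
by field; rewrite gt_eqF.
Qed.

Lemma ge0_integral_affine (c r : R) (f : R -> \bar R) : (0 < r)%R ->
  measurable_fun setT f -> (forall x, 0 <= f x) ->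
  \int[leb]_x f ((x - c) / r)%R = r%:E * \int[leb]_x f x.
Proof.
move=> r0 mf f0.
pose g (x : measurableTypeR R) : measurableTypeR R := ((x - c) / r)%R.
have mg : measurable_fun setT g.
  by apply: measurable_funM => //; exact: measurable_funB.
have -> : \int[leb]_x f ((x - c) / r)%R = \int[pushforward leb g]_x f x.
  by rewrite (ge0_integral_pushforward mg)// preimage_setT.
rewrite -(ge0_integral_mscale leb measurableT (NngNum (ltW r0)))//.
by apply: eq_measure_integral => A mA _; exact: lebesgue_measure_affine.
Qed.

Lemma ge0_integral_mpow_affine n (c : n.-tuple R) (r : R)
    (G : n.-tuple R -> \bar R) : (0 < r)%R ->
  measurable_fun setT G -> (forall u, 0 <= G u) ->
  \int[mpow leb n]_u G [tuple (tnth u i - tnth c i) / r | i < n]%R =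
  (r ^+ n)%:E * \int[mpow leb n]_u G u.
Proof.
move=> r0; elim: n c G => [|n IH] c G mG G0.
  rewrite expr0 mul1e; apply: eq_integral => u _; congr G.
  by apply: eq_from_tnth => -[].
have maff m (e : m.-tuple R) :
    measurable_fun setT
      (fun u : m.-tuple R => [tuple (tnth u i - tnth e i) / r | i < m]%R).
  apply: measurable_mktuple => i; apply: measurable_funM => //.
  by apply: measurable_funB => //; exact: measurable_tnth.
rewrite !ge0_integral_mpow_cons//; last exact: measurableT_comp mG (maff _ _).
pose c' := [tuple tnth c (lift ord0 i) | i < n].
have mtc (x : R) : measurable_fun setT (fun t : n.-tuple R => G (tcons (x, t))).
  apply: (measurableT_comp mG); apply: (measurableT_comp (@measurable_tcons _ _ _)).
  exact: measurable_fun_pair.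
transitivity (\int[leb]_x ((r ^+ n)%:E *
    \int[mpow leb n]_t G (tcons ((x - tnth c ord0) / r, t)%R))).
  apply: eq_integral => x _.
  rewrite -(IH c' (fun t => G (tcons ((x - tnth c ord0) / r, t)%R)))//.
  apply: eq_integral => t _; congr G; apply: eq_from_tnth => i.
  rewrite tnth_mktuple; case: (unliftP ord0 i) => [{}i ->|->//].
  by rewrite /tcons !tnthS/= !tnth_mktuple.
have mI : measurable_fun setT (fun x => \int[mpow leb n]_t G (tcons (x, t))).
  apply: (@measurable_fun_fubini_tonelli_F _ _ _ _ _ (mpow leb n)
    (G \o @tcons _ R n)).
    exact: measurableT_comp mG (@measurable_tcons _ _ _).
  by move=> w; exact: G0.
have I0 x : 0 <= \int[mpow leb n]_t G (tcons (x, t)) by exact: integral_ge0.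
rewrite ge0_integralZl_EFin; last 4 first.
- exact: measurableT.
- by move=> x _; exact: I0.
- apply: (measurableT_comp mI); apply: measurable_funM => //.
  exact: measurable_funB.
- by rewrite exprn_ge0 ?ltW.
rewrite (ge0_integral_affine _ r0 mI I0).
by rewrite muleA -EFinM -exprSr.
Qed.

Lemma mpow_lebesgue_affine n (c : n.-tuple R) (r : R) (A : set (n.-tuple R)) :
  (0 < r)%R -> measurable A ->
  mpow leb n
    [set u : n.-tuple R | A [tuple (tnth u i - tnth c i) / r | i < n]%R] =
  (r ^+ n)%:E * mpow leb n A.
Proof.
move=> r0 mA; have maff : measurable_fun setT
    (fun u : n.-tuple R => [tuple (tnth u i - tnth c i) / r | i < n]%R).
  apply: measurable_mktuple => i; apply: measurable_funM => //.
  by apply: measurable_funB => //; exact: measurable_tnth.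
have mB : measurable
    [set u : n.-tuple R | A [tuple (tnth u i - tnth c i) / r | i < n]%R].
  by rewrite -[X in measurable X]setTI; exact: maff.
have indicE' B : measurable B -> mpow leb n B = \int[mpow leb n]_u (\1_B u)%:E.
  by move=> mB'; rewrite integral_indic// setIT.
rewrite (indicE' _ mB) (indicE' _ mA) -(@ge0_integral_mpow_affine n c)//.
exact/measurable_EFinP/measurable_indic.
Qed.

End lebesgue_dilation.

(** * Volumes of balls and cubes *)

Section euclidean_measure.
Context {R : realType}.
Local Notation leb := (@lebesgue_measure R).

Lemma measurable_eucl_norm d : measurable_fun setT (@eucl_norm R d).
Proof.
apply: (measurableT_comp (f := @Num.sqrt R)).
  by apply: continuous_measurable_fun; exact: sqrt_continuous.
apply: measurable_sum => i; apply: measurable_funX; exact: measurable_tnth.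
Qed.

Lemma measurable_eucl_dist d d1 (T : measurableType d1)
    (f g : T -> d.-tuple R) :
  measurable_fun setT f -> measurable_fun setT g ->
  measurable_fun setT (fun t => eucl_dist (f t) (g t)).
Proof.
move=> mf mg; apply: (measurableT_comp (@measurable_eucl_norm d)).
apply: measurable_mktuple => i; apply: measurable_funB.
  exact: (measurableT_comp (measurable_tnth i)).
exact: (measurableT_comp (measurable_tnth i)).
Qed.

Lemma mpow_lebesgue_cube d (a b : R) : a <= b ->
  mpow leb d [set t | forall i, tnth t i \in `[a, b]] = ((b - a) ^+ d)%:E.
Proof.
move=> ab; rewrite (mpow_box leb (A := fun=> `[a, b]%classic))//.
transitivity (\prod_(i < d) (b - a)%:E)%E.
  apply: eq_bigr => i _; apply: etrans (lebesgue_measure_itv `[a, b]) _.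
  rewrite /= lte_fin; by case: ltgtP ab => // -> _; rewrite subrr.
by rewrite prodEFin prodr_const card_ord.
Qed.

Lemma measurable_cube d (a b : R) :
  measurable [set t : d.-tuple R | forall i, tnth t i \in `[a, b]].
Proof.
rewrite [X in measurable X](_ : _ = \bigcap_(i in [set: 'I_d])
    ((fun t : d.-tuple R => tnth t i) @^-1` `[a, b]%classic)).
  apply: fin_bigcap_measurable => // i _.
  by rewrite -[X in measurable X]setTI; exact: measurable_tnth.
by apply/seteqP; split => [t tab i _|t tab i]; [exact: tab|exact: (tab i I)].
Qed.

Lemma measurable_unit_ball d :
  measurable [set x : d.-tuple R | eucl_norm x <= 1].
Proof.
rewrite -[X in measurable X]setTI.
by apply: measurable_fun_ler => //; exact: measurable_eucl_norm.
Qed.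

Lemma tnth_le_eucl_norm d (x : d.-tuple R) i : `|tnth x i| <= eucl_norm x.
Proof.
rewrite -sqrtr_sqr ler_sqrt ?sumr_ge0//; last by move=> j _; exact: sqr_ge0.
by rewrite (bigD1 i)//= lerDl sumr_ge0// => j _; exact: sqr_ge0.
Qed.

(** The ball lies in the cube of side [2], so its measure is finite and [fine] in the definition of
    the volume loses nothing. *)
Lemma unit_ball_volumeE d :
  mpow leb d [set x | eucl_norm x <= 1] = (unit_ball_volume R d)%:E.
Proof.
rewrite /unit_ball_volume fineK// ge0_fin_numE//.
apply: (@le_lt_trans _ _
    (mpow leb d [set t | forall i, tnth t i \in `[-1, 1]])).
  apply: le_measure; rewrite ?inE;
    [exact: measurable_unit_ball|exact: measurable_cube|].
  move=> x /= x1 i; rewrite in_itv/= -ler_norml.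
  exact: le_trans (tnth_le_eucl_norm x i) x1.
by rewrite mpow_lebesgue_cube ?ltry// lerN10.
Qed.

(** The cube with half-side [1 / d] lies in the unit ball. This yields positivity of the volume and,
    for [d = 1], the lower bound [2] used in the final constant. *)
Lemma unit_ball_volume_ge d : (0 < d)%N ->
  (2 / d%:R) ^+ d <= unit_ball_volume R d.
Proof.
move=> d0; have dR : 0 < d%:R :> R by rewrite ltr0n.
rewrite -lee_fin -unit_ball_volumeE.
have -> : 2 / d%:R = d%:R^-1 - - d%:R^-1 :> R by field; rewrite gt_eqF.
rewrite -mpow_lebesgue_cube; last by rewrite ge0_cp// invr_ge0 ltW.
apply: le_measure; rewrite ?inE;
  [exact: measurable_cube|exact: measurable_unit_ball|].
move=> x /= xd; rewrite /eucl_norm -[leRHS]sqrtr1 ler_sqrt//.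
apply: (@le_trans _ _ (\sum_(i < d) d%:R^-1)); last first.
  by rewrite sumr_const card_ord -[leLHS]mulr_natr mulVf ?gt_eqF.
apply: ler_sum => i _; have := xd i; rewrite in_itv/= -ler_norml => xi.
rewrite -real_normK ?num_real// expr2.
apply: le_trans (ler_pM _ _ xi xi) _ => //.
by rewrite ger_pMr ?invr_gt0// invf_le1// ler1n.
Qed.

Lemma unit_ball_volume_gt0 d : (0 < d)%N -> 0 < unit_ball_volume R d.
Proof.
move=> d0; apply: lt_le_trans (unit_ball_volume_ge d0).
by rewrite exprn_gt0// divr_gt0// ltr0n.
Qed.

Lemma mpow_lebesgue_ball d (c : d.-tuple R) (r : R) : 0 < r ->
  mpow leb d [set y | eucl_dist y c <= r] = (r ^+ d * unit_ball_volume R d)%:E.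
Proof.
move=> r0; rewrite EFinM -unit_ball_volumeE.
rewrite -(mpow_lebesgue_affine c r0); last exact: measurable_unit_ball.
congr (mpow leb d _); apply/seteqP.
suff H y : (eucl_dist y c <= r) =
    (eucl_norm [tuple (tnth y i - tnth c i) / r | i < d] <= 1).
  by split => y /=; rewrite H.
suff -> : eucl_norm [tuple (tnth y i - tnth c i) / r | i < d] =
    eucl_dist y c / r.
  by rewrite ler_pdivrMr// mul1r.
rewrite /eucl_norm eucl_distE.
under eq_bigr do rewrite tnth_mktuple exprMn.
rewrite -mulr_suml sqrtrM ?sumr_ge0//; last by move=> i _; exact: sqr_ge0.
by rewrite sqrtr_sqr ger0_norm// invr_ge0 ltW.
Qed.

(* The open balls of radius [r i / 2] are disjoint. Their volume is bounded
   below by that of the closed balls of radius [3 / 8 * r i], which avoids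
   showing that spheres are null sets; the loss fits in the constant [8] of the
   theorem, as [(8 / 3) ^ 2 <= 8]. *)
Lemma sum_radius_le d N (x : 'I_N -> d.-tuple R) (r : 'I_N -> R) :
  (0 < d)%N ->
  (forall i, unit_cube d (x i)) -> (forall i, 0 <= r i <= Num.sqrt d%:R) ->
  (forall i j, i != j -> r i <= eucl_dist (x i) (x j)) ->
  (\sum_i r i ^+ d) * ((3 / 8) ^+ d * unit_ball_volume R d) <=
  (1 + Num.sqrt d%:R) ^+ d.
Proof.
move=> d0 xc r0d rx.
pose B i := [set y : d.-tuple R | eucl_dist y (x i) < r i / 2].
have mB i : measurable (B i).
  rewrite -[X in measurable X]setTI; apply: measurable_fun_ltr => //.
  exact: measurable_eucl_dist.
(* A common point would put the centers at distance below [(r i + r j) / 2], while that distance is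
   at least both radii. *)
have tB : trivIset setT B.
  apply/trivIsetP => i j _ _ ij; apply/seteqP; split => // y [/= yi yj].
  rewrite /B /= eucl_distC in yi; have := eucl_dist_triangle_lt yi yj.
  have := rx _ _ ij; rewrite eq_sym in ij; have := rx _ _ ij.
  by rewrite (eucl_distC (x j)); lra.
have BV i : ((r i ^+ d * ((3 / 8) ^+ d * unit_ball_volume R d))%:E <=
    mpow leb d (B i))%E.
  have := r0d i; rewrite le_eqVlt => /andP[/predU1P[<- _|ri _]].
    by rewrite expr0n eqn0Ngt d0 mul0r.
  rewrite mulrA -exprMn -(mpow_lebesgue_ball (x i)) ?mulr_gt0//.
  have mC : measurable [set y : d.-tuple R | eucl_dist y (x i) <= r i * (3 / 8)].
    rewrite -[X in measurable X]setTI; apply: measurable_fun_ler => //.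
    exact: measurable_eucl_dist.
  apply: le_measure; rewrite ?inE; [exact: mC|exact: mB|].
  by move=> y /= /le_lt_trans; apply; lra.
rewrite mulr_suml -lee_fin -sumEFin.
apply: (@le_trans _ _ (\sum_(i < N) mpow leb d (B i))%E); first exact: lee_sum.
rewrite -measure_bigsetU_ord//.
(* Each ball has radius at most [sqrt d / 2] and center in the unit cube, so the union lies in the
   cube enlarged by [sqrt d / 2] on every side. *)
have -> : 1 + Num.sqrt d%:R =
    (1 + Num.sqrt d%:R / 2) - - (Num.sqrt d%:R / 2) :> R by lra.
have s0 : 0 <= Num.sqrt d%:R :> R by exact: sqrtr_ge0.
rewrite -mpow_lebesgue_cube; last by lra.
apply: le_measure; rewrite ?inE;
  [by apply: bigsetU_measurable => i _; exact: mB|exact: measurable_cube|].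
apply: (big_ind (fun S => S `<=` _)) => [y []||i _ y /= yi l].
  by move=> S1 S2 S1c S2c y [/S1c|/S2c].
have := tnth_le_eucl_norm [tuple tnth y j - tnth (x i) j | j < d] l.
rewrite tnth_mktuple -/(eucl_dist y (x i)) => yl.
have := xc i l; have /andP[_ rid] := r0d i.
have := le_lt_trans yl yi; rewrite ltr_norml in_itv/= => /andP[] *.
by apply/andP; split; lra.
Qed.

End euclidean_measure.

(** * Nearest-neighbor distances *)

Lemma measurable_bigminr d (T : measurableType d) (R : realType) (I : Type)
    (s : seq I) (p : pred I) (x0 : R) (f : I -> T -> R) :
  (forall i, measurable_fun setT (f i)) ->
  measurable_fun setT (fun t => \big[Num.min/x0]_(i <- s | p i) f i t).
Proof.
move=> mf; elim: s => [|i s IH].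
  rewrite (_ : (fun _ => _) = cst x0)//.
  by apply/funext => t; rewrite big_nil.
pose g t := \big[Num.min/x0]_(j <- s | p j) f j t.
rewrite (_ : (fun _ => _) = if p i then (fun t => Num.min (f i t) (g t)) else g).
  by case: (p i) => //; exact: measurable_minr.
by apply/funext => t; rewrite big_cons; case: (p i).
Qed.

(** Failure at one coordinate is contained in a cylinder over a null set, whose product measure has
    a zero factor; there are finitely many coordinates. *)
Lemma ae_mpow_coord d (T : measurableType d) (R : realType)
    (P : probability T R) n (Q : T -> Prop) :
  {ae P, forall x, Q x} -> {ae mpow P n, forall u, forall i, Q (tnth u i)}.
Proof.
move=> [N [mN PN0 QN]]; apply: filter_forall => i.
exists [set u | N (tnth u i)]; split.
- by rewrite -[X in measurable X]setTI; exact: measurable_tnth.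
- pose A j := if j == i then N else setT.
  rewrite (_ : [set u | _] = [set u | forall j, A j (tnth u j)]).
    rewrite (mpow_box P (A := A)) => [|j]; last by rewrite /A; case: ifP.
    by rewrite (bigD1 i)//= /A eqxx PN0 mul0e.
  apply/seteqP; split => [u uN j|u /(_ i)]; last by rewrite /A eqxx.
  by rewrite /A; case: eqP => // ->.
- by move=> u /= NQ; apply: QN.
Qed.

Section nearest_neighbor_radius.
Context {R : realType} (d : nat).
Local Notation X := (d.-tuple R).

(* Capped at [sqrt d], the diameter of the unit cube. *)
Definition nn_radius N (u : N.-tuple (X * R)) (j : 'I_N) : R :=
  \big[Num.min/Num.sqrt d%:R]_(i | i != j) eucl_dist (tnth u i).1 (tnth u j).1.

(** Characterizing the radius by its lower bounds reduces its invariance under reindexing to an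
    equivalence, with no manipulation of the minimum. *)
Lemma nn_radius_ge N (u : N.-tuple (X * R)) j v :
  v <= nn_radius u j <-> v <= Num.sqrt d%:R /\
    forall i, i != j -> v <= eucl_dist (tnth u i).1 (tnth u j).1.
Proof. by split=> [/bigmin_geP|] // H; apply/bigmin_geP. Qed.

Lemma nn_radius_ge0 N (u : N.-tuple (X * R)) j : 0 <= nn_radius u j.
Proof.
by apply/nn_radius_ge; split=> [|i _]; [exact: sqrtr_ge0|exact: eucl_dist_ge0].
Qed.

Lemma nn_radius_perm N (u : N.-tuple (X * R)) (f : 'I_N -> 'I_N) j :
  bijective f -> nn_radius [tuple tnth u (f i) | i < N] j = nn_radius u (f j).
Proof.
move=> [g fK gK].
suff H v : v <= nn_radius [tuple tnth u (f i) | i < N] j <->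
    v <= nn_radius u (f j).
  by apply/le_anti/andP; split; apply/H.
rewrite !nn_radius_ge; split=> -[vd H]; split => // i ij.
- have := H (g i); rewrite !tnth_mktuple gK; apply.
  by apply: contraNneq ij => <-; rewrite gK.
- rewrite !tnth_mktuple; apply: H.
  by rewrite (inj_eq (can_inj fK)).
Qed.

Lemma measurable_nn_radius N j :
  measurable_fun setT (fun u : N.-tuple (X * R) => nn_radius u j).
Proof.
apply: measurable_bigminr => i; apply: measurable_eucl_dist;
  exact: (measurableT_comp measurable_fst (measurable_tnth _)).
Qed.

(** The volume of the enlarged cube divided by that of a ball of radius [3 / 8]: the bound that
    packing gives for the sum of the [d]-th powers of the radii. *)
Definition packing_constant : R :=
  (8 / 3 * (1 + Num.sqrt d%:R)) ^+ d / unit_ball_volume R d.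

Hypothesis d_gt0 : (0 < d)%N.

Lemma packing_constant_gt0 : 0 < packing_constant.
Proof.
rewrite divr_gt0 ?unit_ball_volume_gt0// exprn_gt0// mulr_gt0//.
Qed.

Lemma sum_nn_radius_le N (u : N.-tuple (X * R)) :
  (forall i, unit_cube d (tnth u i).1) ->
  \sum_j nn_radius u j ^+ d <= packing_constant.
Proof.
move=> uc; have V0 : 0 < unit_ball_volume R d by exact: unit_ball_volume_gt0.
have := @sum_radius_le R d N (fun i => (tnth u i).1) (nn_radius u) d_gt0 uc.
move=> H; rewrite ler_pdivlMr// exprMn.
have {}H :
    (\sum_i nn_radius u i ^+ d) * ((3 / 8) ^+ d * unit_ball_volume R d) <=
    (1 + Num.sqrt d%:R) ^+ d.
  apply: H.
  - by move=> i; rewrite nn_radius_ge0/=; exact: bigmin_le_id.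
  - move=> i j ij; rewrite eucl_distC.
    have [//|_ ->//] := (nn_radius_ge u i (nn_radius u i)).1.
    by rewrite eq_sym.
have -> : (\sum_i nn_radius u i ^+ d) * unit_ball_volume R d =
  (8 / 3) ^+ d *
  ((\sum_i nn_radius u i ^+ d) * ((3 / 8) ^+ d * unit_ball_volume R d)).
  rewrite mulrCA; congr (_ * _); rewrite mulrA -exprMn.
  by rewrite (_ : 8 / 3 * (3 / 8) = 1 :> R) ?expr1n ?mul1r//; field.
by rewrite ler_pM2l// exprn_gt0.
Qed.

Local Open Scope ereal_scope.

(** By exchangeability the [m + 1] radii have the same moment, so [m + 1] times the moment is the
    integral of the sum. For points in the cube that sum is bounded pointwise by packing and the
    power mean inequality. The hypothesis on [e] passes from [r ^ e] to a power of [r ^ d] with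
    exponent [a <= 1], where concavity holds. *)
Lemma integral_nn_radius_le (P : probability (X * R)%type R) m (a e : R) :
  {ae P, forall p, unit_cube d p.1} ->
  (0 < a)%R -> (a <= 1)%R ->
  (forall r, 0 <= r <= Num.sqrt d%:R -> r `^ e <= (r ^+ d) `^ a)%R ->
  \int[mpow P m.+1]_u (nn_radius u ord0 `^ e)%:E <=
    ((packing_constant / m.+1%:R) `^ a)%:E.
Proof.
move=> Pc a0 a1 ea; set I0 := (X in X <= _).
have mr j : measurable_fun setT
    (fun u : m.+1.-tuple (X * R) => (nn_radius u j `^ e)%:E).
  apply/measurable_EFinP; apply: (measurableT_comp (measurable_powR e)).
  exact: measurable_nn_radius.
have IE j : \int[mpow P m.+1]_u (nn_radius u j `^ e)%:E = I0.
  (* Exchanging points [0] and [j] preserves the law of the sample. *)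
  have tinj : injective (tperm (ord0 : 'I_m.+1) j) by exact: perm_inj.
  rewrite /I0 -(ge0_integral_mpow_marginal
    (G := fun u => (nn_radius u ord0 `^ e)%:E) P tinj (mr ord0));
    last by move=> u; rewrite lee_fin powR_ge0.
  apply: eq_integral => u _; rewrite nn_radius_perm ?tpermL//.
  exact: injF_bij.
have N0 : (0 < m.+1%:R :> R)%R by rewrite ltr0n.
rewrite -(@lee_pmul2l _ (m.+1%:R)%:E)//.
have -> : (m.+1%:R)%:E * I0 =
    \int[mpow P m.+1]_u \sum_(j < m.+1) (nn_radius u j `^ e)%:E.
  rewrite ge0_integral_sum//; last by move=> j u _; rewrite lee_fin powR_ge0.
  by rewrite (eq_bigr (fun=> I0))// sumr_const card_ord mule_natl.
apply: (@le_trans _ _ (\int[mpow P m.+1]_u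
    (m.+1%:R * (packing_constant / m.+1%:R) `^ a)%:E)).
  apply: ae_ge0_le_integral => //.
  - by move=> u _; apply: sume_ge0 => j _; rewrite lee_fin powR_ge0.
  - exact: emeasurable_sum.
  - by move=> u _; rewrite lee_fin mulr_ge0// powR_ge0.
  apply: filterS (ae_mpow_coord m.+1 Pc) => u uc _.
  rewrite sumEFin lee_fin.
  apply: (@le_trans _ _ (\sum_(j < m.+1) (nn_radius u j ^+ d) `^ a)%R).
    apply: ler_sum => j _; apply: ea.
    by rewrite nn_radius_ge0/=; exact: bigmin_le_id.
  rewrite -[m.+1 in leRHS]card_ord.
  apply: sum_powR_le => //.
  - by move=> j; rewrite exprn_ge0// nn_radius_ge0.
  - by apply: divr_gt0; [exact: packing_constant_gt0|rewrite card_ord].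
  - by rewrite card_ord mulrC divfK ?gt_eqF//; exact: sum_nn_radius_le.
by rewrite integral_cst// [X in _ * X](mpow_setT P) mule1.
Qed.

End nearest_neighbor_radius.

(** * Risk of the k-nearest neighbor model *)

Section knn_weights.
Context {R : realType} (d n : nat).
Local Notation X := (d.-tuple R).
Variables (s : 'S_n) (k : nat).

(* The weights of [knn - 1_{Y <= z}] as functions of the [n + 1] covariates,
   the test point coming first. *)
Definition sample_of (v : n.+1.-tuple X) : n.-tuple (X * R) :=
  [tuple (tnth v (lift ord0 i), 0) | i < n].

Definition knn_weight (i : 'I_n.+1) (v : n.+1.-tuple X) : R :=
  if unlift ord0 i is Some j then nn_weight (sample_of v) s k (tnth v ord0) j
  else -1.

(** [nn_le] reads only the covariates, so the placeholder responses [0] in [sample_of] lead to the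
    same order as [D]. *)
Lemma nn_weight_covariates p (D : n.-tuple (X * R)) j :
  knn_weight (lift ord0 j) (covariates (tcons (p, D))) = nn_weight D s k p.1 j.
Proof.
rewrite /knn_weight liftK covariates_tcons /nn_weight /nn_order.
suff -> : nn_le (sample_of (tcons (p.1, covariates D))) s
    (tnth (tcons (p.1, covariates D)) ord0) = nn_le D s p.1 by [].
apply/funext => i; apply/funext => l.
by rewrite /nn_le !tnth_mktuple /tcons !tnthS !tnth_mktuple.
Qed.

Lemma measurable_knn_weight i : measurable_fun setT (knn_weight i).
Proof.
rewrite /knn_weight; case: unliftP => [j _|_]//.
(* The sorted list is a function [phi] of the finite table of pairwise comparisons, each of which is
   measurable. *)
pose b (ij : 'I_n * 'I_n) (v : n.+1.-tuple X) :=
  nn_le (sample_of v) s (tnth v ord0) ij.1 ij.2.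
pose phi (r : {ffun 'I_n * 'I_n -> bool}) : R :=
  k%:R^-1 * (j \in take k (sort (fun i l => r (i, l)) (enum 'I_n)))%:R.
rewrite (_ : (fun _ => _) = fun v => phi [ffun ij => b ij v]); last first.
  apply/funext => v; rewrite /nn_weight /nn_order /phi.
  congr (_ * (_ \in take k _)%:R); congr (sort _ _).
  by apply/funext => i1; apply/funext => i2; rewrite ffunE.
apply: measurable_finite_factor => -[i1 i2]; rewrite /b /nn_le/=.
have mdist l : measurable_fun setT
    (fun v : n.+1.-tuple X => eucl_dist (tnth (sample_of v) l).1 (tnth v ord0)).
  apply: measurable_eucl_dist; last exact: measurable_tnth.
  rewrite (_ : (fun _ => _) = fun v : n.+1.-tuple X => tnth v (lift ord0 l)).
    exact: measurable_tnth.
  by apply/funext => v; rewrite tnth_mktuple.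
apply: measurable_or; first exact: measurable_fun_ltr.
by apply: measurable_and => //; exact: measurable_fun_eqr.
Qed.

Lemma knn_noise_sum z p (D : n.-tuple (X * R)) : (k <= n)%N ->
  noise_sum knn_weight z (tcons (p, D)) = knn D s k p.1 z - (p.2 <= z)%R%:R.
Proof.
move=> kn; rewrite knnE// /noise_sum big_ord_recl addrC; congr (_ + _).
  by apply: eq_bigr => j _; rewrite nn_weight_covariates /tcons tnthS.
by rewrite /knn_weight unlift_none mulN1r.
Qed.

Variable F : X -> cumulativeBounded (0 : R) (1 : R).

(** The neighbor weights sum to [1], which balances the weight [-1] of the test point: the bias is
    the average over the neighbors of [F] at the neighbor minus [F] at the test point.
    Cauchy-Schwarz then bounds its square. *)
Lemma knn_mean_sum_sqr_le z p (D : n.-tuple (X * R)) :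
  (0 < k)%N -> (k <= n)%N ->
  mean_sum F knn_weight z (tcons (p, D)) ^+ 2 <=
  k%:R^-1 * \sum_(j in take k (nn_order D s p.1))
    (F (tnth D j).1 z - F p.1 z) ^+ 2.
Proof.
move=> k0 kn; have kR : 0 < k%:R :> R by rewrite ltr0n.
have -> : mean_sum F knn_weight z (tcons (p, D)) =
    k%:R^-1 * \sum_(j in take k (nn_order D s p.1))
      (F (tnth D j).1 z - F p.1 z).
  rewrite -sum_nn_weight /mean_sum big_ord_recl addrC.
  under [RHS]eq_bigr do rewrite mulrBr.
  rewrite sumrB -mulr_suml sum_nn_weight1// mul1r; congr (_ + _).
    by apply: eq_bigr => j _; rewrite nn_weight_covariates /tcons tnthS.
  by rewrite /knn_weight unlift_none mulN1r.
rewrite exprMn expr2 -mulrA ler_pM2l ?invr_gt0//.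
rewrite ler_pdivrMl//.
apply: (le_trans (sqr_sum_le (mem (take k (nn_order D s p.1))) _)).
by rewrite card_take_nn_order.
Qed.

(** The squared weight of the test point is [1], which produces the irreducible term, and that of
    each of the neighbors is [1 / k^2]. *)
Lemma knn_variance_sum z p (D : n.-tuple (X * R)) :
  variance_sum F knn_weight z (tcons (p, D)) =
  F p.1 z * (1 - F p.1 z) + (k%:R^-1 ^+ 2) *
    \sum_(j in take k (nn_order D s p.1))
      (F (tnth D j).1 z * (1 - F (tnth D j).1 z)).
Proof.
rewrite /variance_sum big_ord_recl; congr (_ + _).
  by rewrite /knn_weight unlift_none sqrrN expr1n mul1r.
rewrite mulr_sumr [RHS]big_mkcond; apply: eq_bigr => j _.
rewrite nn_weight_covariates /tcons tnthS /nn_weight.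
by case: ifP; rewrite ?mulr1// mulr0 expr0n mul0r.
Qed.

End knn_weights.

Section sample_risk.
Context {R : realType} (d n : nat).
Local Notation X := (d.-tuple R).
Local Notation mu := (@lebesgue_measure R).
Variables (P : probability (X * R)%type R).
Variable F : X -> cumulativeBounded (0 : R) (1 : R).
Hypothesis hF : is_cond_cdf P F.
Variables (s : 'S_n) (k : nat).
Hypothesis k_le : (k <= n)%N.
Local Open Scope ereal_scope.

Let W := @knn_weight R d n s k.
Let mW := @measurable_knn_weight R d n s k.

Let loss (q : n.+1.-tuple (X * R) * R) := ((noise_sum W q.2 q.1) ^+ 2)%:E.

Let mloss : measurable_fun setT loss.
Proof.
by apply/measurable_EFinP/measurable_funX; exact: measurable_noise_sum.
Qed.

Let loss_ge0 q : 0 <= loss q. Proof. by rewrite lee_fin sqr_ge0. Qed.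

Let loss_int u := \int[mu]_z loss (u, z).

Let mloss_int : measurable_fun setT loss_int.
Proof. exact: (@measurable_fun_fubini_tonelli_F _ _ _ _ _ mu loss). Qed.

Let loss_int_ge0 u : 0 <= loss_int u. Proof. exact: integral_ge0. Qed.

Lemma risk_knnE D : risk P (knn D s k) = \int[P]_p loss_int (tcons (p, D)).
Proof.
apply: eq_integral => p _; apply: eq_integral => z _.
by rewrite /loss /= knn_noise_sum.
Qed.

Lemma risk_knn_ge0 D : 0 <= risk P (knn D s k).
Proof. by rewrite risk_knnE; apply: integral_ge0. Qed.

Lemma measurable_risk_knn : measurable_fun setT (fun D => risk P (knn D s k)).
Proof.
rewrite (_ : (fun _ => _) = fun D => \int[P]_p loss_int (tcons (p, D)));
    last first.
  by apply/funext => D; exact: risk_knnE.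
apply: (@measurable_fun_fubini_tonelli_G _ _ _ _ _ P (loss_int \o @tcons _ _ n)).
  exact: measurableT_comp mloss_int (@measurable_tcons _ _ _).
by move=> q; exact: loss_int_ge0.
Qed.

(** The test point is independent of the sample, so together they form an i.i.d. sample of size
    [n + 1]. Tonelli brings [z] outside, the decomposition applies for each [z], and Tonelli
    restores the order. *)
Lemma integral_risk_knn :
  \int[mpow P n]_D risk P (knn D s k) =
  \int[mpow P n.+1]_u \int[mu]_z
    (mean_sum F W z u ^+ 2 + variance_sum F W z u)%:E.
Proof.
under eq_integral do rewrite risk_knnE.
rewrite -(ge0_integral_mpow_rcons _ mloss_int loss_int_ge0).
rewrite (@fubini_tonelli _ _ _ _ _ (mpow P n.+1) mu loss)//.
rewrite (@fubini_tonelli _ _ _ _ _ (mpow P n.+1) mu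
  (fun q => (mean_sum F W q.2 q.1 ^+ 2 + variance_sum F W q.2 q.1)%:E));
  last 2 first.
- apply/measurable_EFinP/measurable_funD.
    by apply: measurable_funX; exact: (measurable_mean_sum hF mW).
  exact: (measurable_variance_sum hF mW).
- by move=> q; rewrite lee_fin addr_ge0 ?sqr_ge0// variance_sum_ge0.
apply: eq_integral => z _.
transitivity (\int[mpow P n.+1]_u ((noise_sum W z u + 0) ^+ 2)%:E).
  by apply: eq_integral => u _; rewrite addr0.
rewrite (integral_mpow_sqr_cond_cdf hF z (a := fun=> 0%R) mW)//.
by apply: eq_integral => u _; rewrite addr0.
Qed.

End sample_risk.

Lemma ge0_integral_sum_EFin d (T : measurableType d) (R : realType)
    (m : {measure set T -> \bar R}) (I : finType) (p : {pred I})
    (f : I -> T -> R) :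
  (forall i, measurable_fun setT (f i)) -> (forall i t, 0 <= f i t) ->
  (\int[m]_t (\sum_(i in p) f i t)%:E = \sum_(i in p) \int[m]_t (f i t)%:E)%E.
Proof.
move=> mf f0; rewrite -[RHS]big_filter -ge0_integral_sum//.
- by apply: eq_integral => t _; rewrite big_filter sumEFin.
- by move=> i; exact/measurable_EFinP.
- by move=> i t _; rewrite lee_fin.
Qed.

Section knn_bound.
Context {R : realType} (d : nat).
Local Notation X := (d.-tuple R).
Local Notation mu := (@lebesgue_measure R).
Variables (h C M : R) (F : X -> cumulativeBounded (0 : R) (1 : R)).
Hypotheses (h_gt0 : 0 < h) (C_gt0 : 0 < C).
Hypothesis FM : forall x, unit_cube d x -> (dispersion F x <= M%:E)%E.
Hypothesis FC : forall x x', unit_cube d x -> unit_cube d x' ->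
  ('N[mu]_2%:E [EFin \o (F x' \- F x)%R] <= (C * eucl_dist x' x `^ h)%:E)%E.

Lemma measurable_cumulativeBounded x : measurable_fun setT (F x : R -> R).
Proof.
by apply: nondecreasing_measurable => //; exact: cumulative_is_nondecreasing.
Qed.

Lemma integral_sqr_dist_le x x' : unit_cube d x -> unit_cube d x' ->
  (\int[mu]_z ((F x' z - F x z) ^+ 2)%:E <=
    (C ^+ 2 * eucl_dist x' x `^ (2 * h))%:E)%E.
Proof.
move=> xc x'c; have := FC xc x'c; set f := EFin \o _ => Nf.
have -> : (\int[mu]_z ((F x' z - F x z) ^+ 2)%:E = 'N[mu]_2%:E [f] `^ 2)%E.
  rewrite powR_Lnorm//; apply: eq_integral => z _.
  by rewrite /f /= powR_mulrn// real_normK ?num_real.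
have -> : C ^+ 2 * eucl_dist x' x `^ (2 * h) = (C * eucl_dist x' x `^ h) `^ 2.
  rewrite powR_mulrn ?mulr_ge0 ?powR_ge0 ?(ltW C_gt0)//.
  by rewrite exprMn -(powR_mulrn 2 (powR_ge0 _ _)) -powRrM [h * _]mulrC.
rewrite -poweR_EFin; apply: gt0_ler_poweR => //.
- by rewrite in_itv/= Lnorm_ge0 leey.
- by rewrite in_itv/= leey lee_fin mulr_ge0 ?powR_ge0 ?(ltW C_gt0).
Qed.

Section pointwise.
Variables (n k : nat) (s : 'S_n).
Hypotheses (k_gt0 : (0 < k)%N) (k_le : (k <= n)%N).

Let kR : 0 < k%:R :> R. Proof. by rewrite ltr0n. Qed.

(** At fixed covariates in the cube, integration in [z] turns the three terms into the dispersion at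
    the test point, at most [k] dispersion bounds [M] with factor [1 / k^2], and a squared bias
    controlled by the Hoelder condition. *)
Lemma integral_knn_error_le p (D : n.-tuple (X * R)) :
  unit_cube d p.1 -> (forall i, unit_cube d (tnth D i).1) ->
  (\int[mu]_z (mean_sum F (@knn_weight R d n s k) z (tcons (p, D)) ^+ 2 +
     variance_sum F (@knn_weight R d n s k) z (tcons (p, D)))%:E <=
   dispersion F p.1 + ((M / k%:R)%:E +
   (C ^+ 2 / k%:R * \sum_(j in take k (nn_order D s p.1))
      eucl_dist (tnth D j).1 p.1 `^ (2 * h))%:E))%E.
Proof.
move=> pc Dc; pose T := take k (nn_order D s p.1).
have mF x := measurable_cumulativeBounded x.
have FF_ge0 x z : 0 <= F x z * (1 - F x z).
  by rewrite mulr_ge0 ?cumulativeBounded_ge0// subr_ge0 cumulativeBounded_le1.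
have mFF x : measurable_fun setT (fun z => F x z * (1 - F x z)).
  by apply: measurable_funM => //; exact: measurable_funB.
have mdist j : measurable_fun setT (fun z => (F (tnth D j).1 z - F p.1 z) ^+ 2).
  by apply: measurable_funX; exact: measurable_funB.
pose A z := F p.1 z * (1 - F p.1 z).
pose B z := \sum_(j in T) F (tnth D j).1 z * (1 - F (tnth D j).1 z).
pose E z := \sum_(j in T) (F (tnth D j).1 z - F p.1 z) ^+ 2.
have mA : measurable_fun setT A by exact: mFF.
have mB : measurable_fun setT B.
  rewrite (_ : B = fun z =>
      \sum_(j <- enum T) F (tnth D j).1 z * (1 - F (tnth D j).1 z)).
    exact: measurable_sum.
  by apply/funext => z; rewrite big_enum.
have mE : measurable_fun setT E.
  rewrite (_ : E = fun z =>
      \sum_(j <- enum T) (F (tnth D j).1 z - F p.1 z) ^+ 2).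
    exact: measurable_sum.
  by apply/funext => z; rewrite big_enum.
have B0 z : 0 <= B z by apply: sumr_ge0 => j _; exact: FF_ge0.
have E0 z : 0 <= E z by apply: sumr_ge0 => j _; exact: sqr_ge0.
apply: (@le_trans _ _ (\int[mu]_z
    ((A z)%:E + ((k%:R^-1 ^+ 2)%:E * (B z)%:E + (k%:R^-1)%:E * (E z)%:E)))%E).
  apply: ge0_le_integral => //.
  - by move=> z _; rewrite lee_fin addr_ge0 ?sqr_ge0// variance_sum_ge0.
  - apply/measurable_EFinP/measurable_funD.
      apply: measurable_funX; apply: measurable_sum => i.
      by apply: measurable_funM => //; exact: mF.
    by apply: measurable_sum => i; apply: measurable_funM => //; exact: mFF.
  - apply: emeasurable_funD; first exact/measurable_EFinP.
    apply: emeasurable_funD; apply: measurable_funeM; exact/measurable_EFinP.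
  - move=> z _; rewrite -!EFinM -!EFinD lee_fin knn_variance_sum.
    rewrite addrCA lerD2l addrC lerD2l.
    exact: knn_mean_sum_sqr_le.
have k2 : 0 <= k%:R^-1 ^+ 2 :> R by exact: sqr_ge0.
have k1 : 0 <= k%:R^-1 :> R by rewrite invr_ge0 ltW.
rewrite ge0_integralD//; last 4 first.
- by move=> z _; rewrite lee_fin; exact: FF_ge0.
- exact/measurable_EFinP.
- by move=> z _; apply: adde_ge0; apply: mule_ge0; rewrite lee_fin.
- apply: emeasurable_funD; apply: measurable_funeM; exact/measurable_EFinP.
rewrite ge0_integralD//; last 4 first.
- by move=> z _; apply: mule_ge0; rewrite lee_fin.
- by apply: measurable_funeM; exact/measurable_EFinP.
- by move=> z _; apply: mule_ge0; rewrite lee_fin.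
- by apply: measurable_funeM; exact/measurable_EFinP.
have mBE : measurable_fun setT (fun z => (B z)%:E) by exact/measurable_EFinP.
have mEE : measurable_fun setT (fun z => (E z)%:E) by exact/measurable_EFinP.
rewrite !ge0_integralZl_EFin//; last 2 first.
- by move=> z _; rewrite lee_fin.
- by move=> z _; rewrite lee_fin.
apply: leeD; first exact: lexx.
apply: leeD.
  rewrite /B ge0_integral_sum_EFin//; last by move=> j; exact: mFF.
  apply: (@le_trans _ _ ((k%:R^-1 ^+ 2)%:E * \sum_(j in T) M%:E)%E).
    by rewrite lee_wpmul2l// lee_sum// => j _; exact: FM.
  rewrite sumEFin -EFinM lee_fin sumr_const card_take_nn_order//.
  rewrite -[M *+ k]mulr_natr.
  rewrite le_eqVlt; apply/orP; left; apply/eqP; field.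
  by rewrite gt_eqF.
rewrite ge0_integral_sum_EFin; last 2 first.
- by move=> j; exact: mdist.
- by move=> j z; exact: sqr_ge0.
apply: (@le_trans _ _ ((k%:R^-1)%:E *
    \sum_(j in T) (C ^+ 2 * eucl_dist (tnth D j).1 p.1 `^ (2 * h))%:E)%E).
  by rewrite lee_wpmul2l// lee_sum// => j _; exact: integral_sqr_dist_le.
by rewrite sumEFin -EFinM lee_fin -mulr_sumr mulrA [k%:R^-1 * _]mulrC.
Qed.

(** The test point followed by block [b] is an i.i.d. sample of size [n %/ k + 1]; its radius at
    position [0] is the capped distance from the test point to the block. *)
Definition subsample_index (b : 'I_k) (i : 'I_(n %/ k).+1) : 'I_n.+1 :=
  if unlift ord0 i is Some j then lift ord0 (block b j) else ord0.

Definition subsample (b : 'I_k) (u : n.+1.-tuple (X * R)) :=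
  [tuple tnth u (subsample_index b i) | i < (n %/ k).+1].

Lemma subsample_index_inj b : injective (subsample_index b).
Proof.
move=> i j; rewrite /subsample_index.
case: (unliftP ord0 i) => [i' ->|->]; case: (unliftP ord0 j) => [j' ->|->] //.
- by move=> /lift_inj/block_inj ->.
Qed.

(** Apply the block comparison to the nearest point of each block. Its distance is at most [sqrt d]
    for points of the cube, so the cap in [nn_radius] does no harm. *)
Lemma sum_nearest_le_nn_radius p (D : n.-tuple (X * R)) :
  unit_cube d p.1 -> (forall i, unit_cube d (tnth D i).1) ->
  \sum_(j in take k (nn_order D s p.1)) eucl_dist (tnth D j).1 p.1 `^ (2 * h) <=
  \sum_(b < k) nn_radius (subsample b (tcons (p, D))) ord0 `^ (2 * h).
Proof.
move=> pc Dc; have m0 : (0 < n %/ k)%N by rewrite divn_gt0.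
pose dist (b : 'I_k) (i : 'I_(n %/ k)) := eucl_dist (tnth D (block b i)).1 p.1.
(* A minimizer exists because [k <= n] makes the blocks nonempty. *)
pose f (b : 'I_k) := [arg min_(i < Ordinal m0) dist b i]%O.
have fP b i : dist b (f b) <= dist b i.
  by rewrite /f; case: arg_minP => // j _; apply.
have h2 : 0 <= 2 * h by rewrite mulr_ge0// ltW.
have hom : {in Num.nneg &, {homo (fun t : R => t `^ (2 * h)) : u v / u <= v}}.
  exact: ge0_ler_powR.
apply: (le_trans (sum_nearest_le_blocks D s p.1 f k_le hom)).
apply: ler_sum => b _; apply: hom; rewrite ?nnegrE ?eucl_dist_ge0 ?nn_radius_ge0//.
apply/nn_radius_ge; split; first exact: unit_cube_eucl_dist_le.
move=> i; case: (unliftP ord0 i) => [{}i -> _|->]; last by rewrite eqxx.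
rewrite !tnth_mktuple /subsample_index liftK unlift_none /tcons tnthS.
exact: fP.
Qed.

End pointwise.
End knn_bound.

(** * Expected risk of the model and the final constants *)

Section expected_risk.
Context {R : realType} (d : nat).
Local Notation X := (d.-tuple R).
Local Notation mu := (@lebesgue_measure R).
Variables (h C M : R) (P : probability (X * R)%type R).
Variable F : X -> cumulativeBounded (0 : R) (1 : R).
Hypothesis d_gt0 : (0 < d)%N.
Hypotheses (h_gt0 : 0 < h) (C_gt0 : 0 < C) (M_gt0 : 0 < M).
Hypothesis hF : is_cond_cdf P F.
Hypothesis Pc : {ae P, forall p, unit_cube d p.1}.
Hypothesis FM : forall x, unit_cube d x -> (dispersion F x <= M%:E)%E.
Hypothesis FC : forall x x', unit_cube d x -> unit_cube d x' ->
  ('N[mu]_2%:E [EFin \o (F x' \- F x)%R] <= (C * eucl_dist x' x `^ h)%:E)%E.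
Variables (n k : nat).
Hypotheses (k_gt0 : (0 < k)%N) (k_le : (k <= n)%N).
Variable a : R.
Hypotheses (a_gt0 : 0 < a) (a_le1 : a <= 1).
Hypothesis radius_le : forall r : R, 0 <= r <= Num.sqrt d%:R ->
  r `^ (2 * h) <= (r ^+ d) `^ a.

Let kR : 0 < k%:R :> R. Proof. by rewrite ltr0n. Qed.

Let B := M / k%:R + C ^+ 2 * (packing_constant d / (n %/ k).+1%:R) `^ a.

Local Open Scope ereal_scope.

Lemma integral_risk_knn_le (s : 'S_n) :
  \int[mpow P n]_D risk P (knn D s k) <= irreducible_risk P F + B%:E.
Proof.
rewrite (integral_risk_knn hF s k_le).
pose rad (b : 'I_k) (u : n.+1.-tuple (X * R)) :=
  (nn_radius (subsample b u) ord0 `^ (2 * h))%R.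
have mrad b : measurable_fun setT (rad b).
  apply: (measurableT_comp (measurable_powR (2 * h))).
  apply: (measurableT_comp (@measurable_nn_radius R d _ ord0)).
  by apply: measurable_mktuple => i; exact: measurable_tnth.
have rad0 b u : (0 <= rad b u)%R by exact: powR_ge0.
have mdisp : measurable_fun setT
    (fun u : n.+1.-tuple (X * R) => dispersion F (tnth u ord0).1).
  apply: (measurableT_comp (measurable_dispersion hF)).
  exact: (measurableT_comp measurable_fst (measurable_tnth ord0)).
have C2k : (0 <= C ^+ 2 / k%:R)%R by rewrite divr_ge0 ?sqr_ge0// ltW.
have Mk : (0 <= M / k%:R)%R by rewrite divr_ge0 ?(ltW M_gt0)// ltW.
have msum : measurable_fun setT (fun u => \sum_(b < k) rad b u)%R.
  exact: measurable_sum.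
have sum0 u : (0 <= \sum_(b < k) rad b u)%R by apply: sumr_ge0.
apply: (@le_trans _ _ (\int[mpow P n.+1]_u (dispersion F (tnth u ord0).1 +
    ((M / k%:R)%:E + (C ^+ 2 / k%:R)%:E * (\sum_(b < k) rad b u)%:E)))).
  apply: ae_ge0_le_integral => //.
  - move=> u _; apply: integral_ge0 => z _.
    by rewrite lee_fin addr_ge0 ?sqr_ge0// variance_sum_ge0.
  - apply: (@measurable_fun_fubini_tonelli_F _ _ _ _ _ mu
      (fun q => (mean_sum F (@knn_weight R d n s k) q.2 q.1 ^+ 2 +
        variance_sum F (@knn_weight R d n s k) q.2 q.1)%:E)).
      apply/measurable_EFinP/measurable_funD.
        apply: measurable_funX; apply: (measurable_mean_sum hF).
        exact: measurable_knn_weight.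
      by apply: (measurable_variance_sum hF); exact: measurable_knn_weight.
    by move=> q; rewrite lee_fin addr_ge0 ?sqr_ge0// variance_sum_ge0.
  - move=> u _; apply: adde_ge0; first exact: dispersion_ge0.
    by apply: adde_ge0; [rewrite lee_fin|apply: mule_ge0; rewrite lee_fin].
  - apply: emeasurable_funD => //; apply: emeasurable_funD => //.
    by apply: measurable_funeM; exact/measurable_EFinP.
  apply: filterS (ae_mpow_coord n.+1 Pc) => u; case/tupleP: u => p D uc _.
  have pc : unit_cube d p.1 by exact: (uc ord0).
  have Dc i : unit_cube d (tnth D i).1.
    by have := uc (lift ord0 i); rewrite tnthS.
  apply: le_trans (integral_knn_error_le C_gt0 FM FC s k_gt0 k_le pc Dc) _.
  apply: leeD; first exact: lexx.
  apply: leeD; first exact: lexx.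
  rewrite -EFinM lee_fin; apply: ler_wpM2l => //.
  exact: sum_nearest_le_nn_radius.
rewrite ge0_integralD//; last 3 first.
- by move=> u _; exact: dispersion_ge0.
- by move=> u _; apply: adde_ge0; [rewrite lee_fin|apply: mule_ge0; rewrite lee_fin].
- apply: emeasurable_funD => //.
  by apply: measurable_funeM; exact/measurable_EFinP.
apply: leeD.
  (* The dispersion depends on the test point only, whose law is [P]; the other [n] coordinates
     integrate to [1]. *)
  rewrite ge0_integral_mpow_cons//; last by move=> u; exact: dispersion_ge0.
  apply: ge0_le_integral => //.
  - by move=> p _; apply: integral_ge0 => t _; exact: dispersion_ge0.
  - apply: (@measurable_fun_fubini_tonelli_F _ _ _ _ _ (mpow P n)
      ((fun u : n.+1.-tuple (X * R) => dispersion F (tnth u ord0).1) \o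
        @tcons _ _ n)).
      exact: measurableT_comp mdisp (@measurable_tcons _ _ _).
    by move=> q; exact: dispersion_ge0.
  - exact: (measurableT_comp (measurable_dispersion hF)).
  - move=> p _; rewrite -[leRHS]mule1 -[X in _ <= _ * X](mpow_setT P n).
    by rewrite -integral_cst.
rewrite ge0_integralD//; last 2 first.
- by move=> u _; apply: mule_ge0; rewrite lee_fin.
- by apply: measurable_funeM; exact/measurable_EFinP.
rewrite integral_cst// [X in _ * X + _](mpow_setT P) mule1 /B EFinD.
apply: leeD; first exact: lexx.
rewrite ge0_integralZl_EFin//; last 2 first.
- by move=> u _; rewrite lee_fin.
- exact/measurable_EFinP.
rewrite (ge0_integral_sum_EFin _ xpredT mrad rad0).
(* Every block obeys the same moment bound, so the sum over [k] blocks cancels the factor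
   [1 / k]. *)
apply: (@le_trans _ _ ((C ^+ 2 / k%:R)%:E * \sum_(b < k)
    ((packing_constant d / (n %/ k).+1%:R) `^ a)%:E)).
  apply: lee_wpmul2l => //; apply: lee_sum => b _.
  rewrite /rad /subsample.
  rewrite (ge0_integral_mpow_marginal
    (G := fun v => (nn_radius v ord0 `^ (2 * h))%:E) P
    (@subsample_index_inj n k b)); last 2 first.
  - apply/measurable_EFinP; apply: (measurableT_comp (measurable_powR (2 * h))).
    exact: measurable_nn_radius.
  - by move=> v; rewrite lee_fin powR_ge0.
  exact: integral_nn_radius_le.
rewrite sumEFin sumr_const card_ord -EFinM lee_fin.
rewrite -[X in (_ * X <= _)%R]mulr_natr.
rewrite le_eqVlt; apply/orP; left; apply/eqP; field.
by rewrite gt_eqF.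
Qed.

(** The bound is the same for each tie-breaking permutation, so it survives averaging over the [n!]
    of them. *)
Lemma expected_risk_knn_le :
  expected_risk_knn P n k <= irreducible_risk P F + B%:E.
Proof.
have nf : (0 < n`!%:R :> R)%R by rewrite ltr0n fact_gt0.
rewrite /expected_risk_knn ge0_integralZl_EFin//; last 2 first.
- by move=> D _; apply: sume_ge0 => s _; exact: risk_knn_ge0.
- by apply: emeasurable_sum => s; exact: measurable_risk_knn.
rewrite ge0_integral_sum//; last 2 first.
- by move=> s; exact: measurable_risk_knn.
- by move=> s D _; exact: risk_knn_ge0.
apply: (@le_trans _ _ ((n`!%:R^-1)%:E * \sum_(s : 'S_n)
    (irreducible_risk P F + B%:E))).
  apply: lee_wpmul2l; first by rewrite lee_fin invr_ge0 ltW.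
  by apply: lee_sum => s _; exact: integral_risk_knn_le.
have -> : \sum_(s : 'S_n) (irreducible_risk P F + B%:E) =
    (n`!%:R)%:E * (irreducible_risk P F + B%:E).
  by rewrite mule_natl sumr_const card_Sn.
by rewrite muleA -EFinM mulVf ?gt_eqF// mul1e.
Qed.

End expected_risk.

(** For [d >= 2] the exponent [2h / d] is at most [1] and equality holds. For [d = 1] the exponent
    [2h] may exceed [1], so concavity is kept by lowering it to [h], which is allowed since
    [r <= 1]. This is the source of the two rates. *)
Lemma radius_powR_le (R : realType) d (h r : R) : (0 < d)%N -> 0 < h ->
  0 <= r <= Num.sqrt d%:R ->
  r `^ (2 * h) <= (r ^+ d) `^ (if d == 1%N then h else 2 * h / d%:R).
Proof.
move=> d0 h0 /andP[r0 rd]; case: eqP => [d1|_]; last first.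
  by rewrite -(powR_mulrn d r0) -powRrM [d%:R * _]mulrC divfK// pnatr_eq0 -lt0n.
rewrite d1 expr1; move: rd; rewrite d1 sqrtr1 => r1.
move: r0; rewrite le_eqVlt => /predU1P[<-|r0].
  by rewrite !powR0 ?gt_eqF ?mulr_gt0.
by rewrite ger_powR ?r0//; lra.
Qed.

Lemma packing_constant_powR_le (R : realType) d (h : R) : (1 < d)%N -> 0 < h ->
  packing_constant d `^ (2 * h / d%:R) <= nn_constant R d `^ h.
Proof.
move=> d1 h0; have d0 : (0 < d)%N by exact: ltnW.
have dR : 0 < d%:R :> R by rewrite ltr0n.
have V0 : 0 < unit_ball_volume R d by exact: unit_ball_volume_gt0.
have s0 : 0 <= Num.sqrt d%:R :> R by exact: sqrtr_ge0.
have -> : 2 * h / d%:R = 2 / d%:R * h by rewrite mulrAC.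
rewrite powRrM; apply: ge0_ler_powR; rewrite ?nnegrE ?powR_ge0 ?(ltW h0)//.
  by rewrite divr_ge0 ?powR_ge0// mulr_ge0 ?powR_ge0// sqr_ge0.
have c0 : 0 <= 8 / 3 * (1 + Num.sqrt d%:R) :> R by rewrite mulr_ge0// addr_ge0.
rewrite /packing_constant /nn_constant powRM ?exprn_ge0 ?invr_ge0 ?(ltW V0)//.
rewrite -(powR_inv1 (ltW V0)) -powRrM mulN1r powRN.
rewrite ler_pM2r ?invr_gt0 ?powR_gt0//.
rewrite -(powR_mulrn d c0) -powRrM [d%:R * _]mulrC divfK ?gt_eqF// powR_mulrn//.
rewrite exprMn ler_wpM2r ?sqr_ge0//.
(* [(8 / 3)^2 = 64 / 9 <= 8], so the packing constant fits below [2 ^ (3 + 2 / d)]. *)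
apply: (@le_trans _ _ (2 `^ 3%:R)); first by rewrite powR_mulrn//; lra.
by apply: ler_powR; rewrite ?ler1n// lerDl divr_ge0.
Qed.

Unset Implicit Arguments.

Theorem proposition1 (R : realType) (d : nat) (hd : (1 <= d)%N) (h C M : R)
  (h_gt0 : 0 < h) (h_le1 : h <= 1) (C_gt0 : 0 < C) (M_gt0 : 0 < M)
  (P : probability (d.-tuple R * R)%type R)
  (Fstar : d.-tuple R -> cumulativeBounded (0 : R) (1 : R))
  (hFstar : is_cond_cdf P Fstar) (hP : class_D h C M P)
  (n k : nat) (k_ge1 : (1 <= k)%N) (k_le : (k <= n)%N) :
  (expected_risk_knn P n k - risk P Fstar <=
   (if d == 1%N then
      8 `^ h * C ^+ 2 * (k%:R / n%:R) `^ h + M / k%:R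
    else
      nn_constant R d `^ h * C ^+ 2 * (k%:R / n%:R) `^ (2 * h / d%:R) + M / k%:R)%:E)%E.
Proof.
case: hP => F [hF Pc FM FC].
have d_gt0 : (0 < d)%N by [].
have Pc' : {ae P, forall p, unit_cube d p.1}.
  case: Pc => N [mN PN0 cN]; exists (fst @^-1` N); split => //.
    by rewrite -[X in measurable X]setTI; exact: measurable_fst.
  by move=> p /= pc; exact: cN.
set bound := (X in (_ <= X%:E)%E).
(* Finiteness allows the irreducible risk to be moved across the inequality at the end. *)
have irr_fin : irreducible_risk P F \is a fin_num.
  rewrite ge0_fin_numE ?irreducible_risk_ge0//.
  exact: le_lt_trans (irreducible_risk_le_cst hF (ltW M_gt0) Pc' FM) (ltry _).
have risk_le : (expected_risk_knn P n k <= irreducible_risk P F + bound%:E)%E.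
  pose a : R := if d == 1%N then h else 2 * h / d%:R.
  have kR : 0 < k%:R :> R by rewrite ltr0n.
  have nR : 0 < n%:R :> R by rewrite ltr0n (leq_trans k_ge1).
  have dR : 0 < d%:R :> R by rewrite ltr0n.
  have a_gt0 : 0 < a.
    by rewrite /a; case: eqP => // _; rewrite divr_gt0// mulr_gt0.
  have a_le1 : a <= 1.
    rewrite /a; case: eqP => // /eqP d1; rewrite ler_pdivrMr// mul1r.
    have : 2 <= d%:R :> R by rewrite ler_nat ltn_neqAle eq_sym d1.
    by move: h_le1; lra.
  have := expected_risk_knn_le d_gt0 h_gt0 C_gt0 M_gt0 hF Pc' FM FC k_ge1 k_le
    a_gt0 a_le1 (fun r => radius_powR_le d_gt0 h_gt0).
  move=> /le_trans; apply; apply: leeD; first exact: lexx.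
  have K0 : 0 < packing_constant d :> R by exact: packing_constant_gt0.
  have kn0 : 0 <= k%:R / n%:R :> R by rewrite divr_ge0// ltW.
  (* The test point counts as one more point in each block, and [n < k (floor (n / k) + 1)], so
     rounding costs no constant. *)
  have block_le : (packing_constant d / (n %/ k).+1%:R) `^ a <=
      packing_constant d `^ a * (k%:R / n%:R) `^ a.
    rewrite -powRM// ?(ltW K0)//.
    apply: ge0_ler_powR; rewrite ?nnegrE ?(ltW a_gt0)//.
    - by rewrite divr_ge0// ltW.
    - by rewrite mulr_ge0// ltW.
    rewrite ler_pM2l// -[k%:R / _]invf_div lef_pV2 ?posrE ?divr_gt0//.
    by rewrite ler_pdivrMr// -natrM ler_nat ltnW// ltn_ceil.
  rewrite lee_fin /bound.
  have const_le c : packing_constant d `^ a <= c ->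
      C ^+ 2 * (packing_constant d / (n %/ k).+1%:R) `^ a <=
      c * C ^+ 2 * (k%:R / n%:R) `^ a.
    move=> Kc; rewrite -mulrA mulrCA ler_wpM2l ?sqr_ge0//.
    by apply: le_trans block_le _; rewrite ler_wpM2r ?powR_ge0.
  rewrite addrC; case: eqP => [d1|/eqP d1]; rewrite lerD2r;
    rewrite /a ?d1 ?(negbTE d1) /= in const_le *.
  - apply: const_le; apply: ge0_ler_powR; rewrite ?nnegrE ?(ltW h_gt0)//.
      by rewrite -d1 ltW.
    (* For [d = 1] the packing constant is [16 / 3] divided by a volume at least [2], hence below
       [8]. *)
    rewrite /packing_constant expr1 sqrtr1 ler_pdivrMr.
      have := @unit_ball_volume_ge R 1 isT; rewrite expr1 divr1; lra.
    exact: unit_ball_volume_gt0.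
  - apply: const_le; apply: packing_constant_powR_le => //.
    by rewrite ltn_neqAle eq_sym d1.
(* [Fstar] may differ from the version [F] of the class; its risk is at least the irreducible risk
   of [F], so subtracting it gives no more. *)
apply: (@le_trans _ _ (expected_risk_knn P n k - irreducible_risk P F)%E).
  apply: leeB; first exact: lexx.
  exact: (irreducible_risk_le hF hFstar.1).
by rewrite leeBlDl.
Qed.
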